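(* Let $d\ge2$, $H\le\Sigma_d$, and let $\pi:V_d'(H)\to V_d'(H)_{ab}=V_d'(H)/[V_d'(H),V_d'(H)]$ be the canonical projection. The composite $H\to V_d'(H)_{ab}$, $h\mapsto\pi(\Lambda_1(h))$, is a surjective homomorphism, and its kernel is $N=\langle[H,H],H^{d-1}\rangle$ if $d$ is even, and $N=\langle[H,H],(H\cap A_d)^{d-1}\rangle$ if $d$ is odd. In particular $V_d'(H)_{ab}\cong H/N$ (a finite group).
   Context: $A=\{a_1,\dots,a_d\}$ (identified with $\{1,\dots,d\}$), $A^\omega$ the infinite words with ultrametric $d(x,y)=e^{1-n}$ ($n$ the first index where $x,y$ differ); balls are the sets $wA^\omega$, $w$ a finite word. $\Sigma_d$ is the symmetric group on $A$ acting letterwise on $A^\omega$, $A_d$ its alternating subgroup. $V_d(H)$ is the group of homeomorphisms $g$ of $A^\omega$ such that every point lies in a ball $w_1A^\omega$ on which $g$ has the form $w_1y\mapsto w_2\sigma(y)$ for some finite word $w_2$ and $\sigma\in H$; $H$ is identified with the subgroup of $V_d(H)$ acting letterwise. Every $g\in V_d(H)$ admits a *table*: finite words $v_1<\dots<v_m$ and $u_1<\dots<u_m$ (lexicographic order) such that $\{v_iA^\omega\}$ and $\{u_iA^\omega\}$ are partitions of $A^\omega$, elements $h_1,\dots,h_m\in H$ and $\tau\in\Sigma_m$ with $g(v_iy)=u_{\tau(i)}h_i(y)$ for all $i$ and $y$; the table is *even/odd* according to the parity of $\tau$. If $d$ is odd and $H\le A_d$, the parity of a table of $g$ does not depend on the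 table, and $V_d'(H)$ is defined as the index-2 subgroup of elements with even tables; otherwise (if $d$ is even, or $H$ contains an odd permutation) $V_d'(H)=V_d(H)$. For $h\in H$, $\Lambda_1(h)\in V_d'(H)$ is the homeomorphism $a_1y\mapsto a_1h(y)$ on $a_1A^\omega$ and the identity off $a_1A^\omega$. For a group $G$, $G^k=\{g^k:g\in G\}$ and $\langle\cdot\rangle$ is the subgroup generated. *)

(* Defs.v *)
From mathcomp Require Import all_boot all_fingroup all_solvable.
Set Implicit Arguments. Unset Strict Implicit. Unset Printing Implicit Defensive.
Local Open Scope group_scope.

(* Infinite words over A = 'I_d (letter a_k is the ordinal k-1). *)
Definition word (d : nat) := nat -> 'I_d.

Definition app d (w : seq 'I_d) (y : word d) : word d :=
  fun n => if n < size w then nth (y 0%N) w n else y (n - size w)%N.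

Definition inball d (w : seq 'I_d) (x : word d) : Prop :=
  forall n, n < size w -> x n = nth (x n) w n.

Definition lact d (s : {perm 'I_d}) (y : word d) : word d := fun n => s (y n).

Fixpoint lexlt d (s t : seq 'I_d) : bool :=
  match s, t with
  | [::], _ :: _ => true
  | _, [::] => false
  | a :: s', b :: t' => (nat_of_ord a < nat_of_ord b) || ((a == b) && lexlt s' t')
  end.

Definition ball_partition d m (v : 'I_m -> seq 'I_d) : Prop :=
  forall x : word d, exists! i : 'I_m, inball (v i) x.

(* V_d(H): homeomorphisms of A^omega locally of the form w1 y |-> w2 sigma(y),
   sigma in H.  (Bijectivity + this local form = homeomorphism, the local form
   giving continuity, and a continuous bijection of a compact Hausdorff space
   being a homeomorphism.) *)
Definition inV d (H : {set {perm 'I_d}}) (g : word d -> word d) : Prop :=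
  (exists ginv : word d -> word d,
      (forall x, ginv (g x) = x) /\ (forall x, g (ginv x) = x)) /\
  forall x : word d, exists (w1 w2 : seq 'I_d) (s : {perm 'I_d}),
    [/\ s \in H, inball w1 x & forall y, g (app w1 y) = app w2 (lact s y)].

Definition has_even_table d (H : {set {perm 'I_d}}) (g : word d -> word d) : Prop :=
  exists (m : nat) (v u : 'I_m -> seq 'I_d) (hs : 'I_m -> {perm 'I_d}) (tau : {perm 'I_m}),
    (forall i j : 'I_m, i < j -> lexlt (v i) (v j)) /\
    (forall i j : 'I_m, i < j -> lexlt (u i) (u j)) /\
    ball_partition v /\ ball_partition u /\
    (forall i, hs i \in H) /\
    (forall i y, g (app (v i) y) = app (u (tau i)) (lact (hs i) y)) /\
    ~~ odd_perm tau.

Definition inV' d (H : {set {perm 'I_d}}) (g : word d -> word d) : Prop :=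
  inV H g /\ (if odd d && (H \subset 'Alt_('I_d)) then has_even_table H g else True).

Inductive commsub d (G : (word d -> word d) -> Prop) : (word d -> word d) -> Prop :=
| commsub1 (f : word d -> word d) : (forall x, f x = x) -> commsub G f
| commsubM (f g a b ai bi : word d -> word d) :
    commsub G f -> G a -> G b ->
    (forall x, ai (a x) = x) -> (forall x, a (ai x) = x) ->
    (forall x, bi (b x) = x) -> (forall x, b (bi x) = x) ->
    (forall x, g x = f (ai (bi (a (b x))))) -> commsub G g.

Definition Lambda1 d (a1 : 'I_d) (h : {perm 'I_d}) (x : word d) : word d :=
  fun n => if (x 0%N == a1) && (n != 0%N) then h (x n) else x n.

Definition Nsub d (H : {group {perm 'I_d}}) : {set {perm 'I_d}} :=
  if odd d then <<[~: H, H] :|: [set h ^+ d.-1 | h in H :&: 'Alt_('I_d)]>>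
  else <<[~: H, H] :|: [set h ^+ d.-1 | h in H]>>.

(* Main.v *)
(** An element of V_d(H) has a table of rows (v, u, h), acting by v y |-> u h(y);
    splitting a row into its d children multiplies the product of the labels h
    (in an abelian quotient of H) by h^(d-1) and, for d odd, the sign of the
    permutation of the lexicographically ordered balls by sgn h.  Hence the labels
    together with the sign define an invariant with values in H/N, additive under
    composition, whose value at Lambda_1(h) is the class of h; this bounds the
    kernel by N.

    Conversely V_d(H) is generated by swaps of two disjoint small balls and by the
    copies Lambda_w(h) of H: move the targets of a caret of the source partition
    onto a caret of the target partition, and merge.  In the abelianization all
    small swaps have the same class s, with 2s = 0 and ds = s, all Lambda_w(h) have
    the class of Lambda_1(h), and splitting the ball w once gives
    (d-1) Lambda_1(h) = s sgn(h).  When d is odd and H is contained in A_d, two small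
    generators commute with a common odd swap, so that [V, V] = [V', V']. *)
From HB Require Import structures.
Require Import Defs.
From mathcomp Require Import all_boot ssralg all_fingroup all_solvable.
From mathcomp Require Import generic_quotient boolp.
Set Implicit Arguments. Unset Strict Implicit. Unset Printing Implicit Defensive.
Import GRing.Theory.
Local Open Scope quotient_scope.

(** Both bounds rest on one set of relations. An invariant built from labels [eta] and an inversion
    weight [eps] survives splitting as soon as 2 eps = 0, d eps = eps and (d-1) eta(h) = eps sgn(h);
    the class of a small swap and the classes of the [lam w h] satisfy the same three relations in
    the abelianization. With Z/2 as target, [eta] zero and [eps] nonzero, the same invariant is the
    parity of a table, so parity needs no separate theory.

    The obstacle to identifying classes is room: the conjugations used here move one ball at a time
    to a ball disjoint from the others involved, and large balls may leave none. Generators are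
    therefore pushed down to depth 3, where four balls never exhaust the at least 8 balls of that
    depth.

    The abelianization is computed for V_d(H), which contains every swap, and not for V_d'(H), which
    may miss the odd ones. The result is carried over by the equality of the derived subgroups, and
    the extra class of the swap is then excluded by parity. *)

Section AbelianQuotient.
Local Open Scope group_scope.

(** The groups are predicates on a possibly infinite type, so V/C is built by hand as a quotient
    type. It serves twice: for V_d(H) modulo its commutators and for H modulo N. *)
Lemma abelian_quotient (G : groupType) (V C : G -> Prop) :
    V 1 -> (forall x y, V x -> V y -> V (x * y)) ->
    C 1 -> (forall x y, C x -> C y -> C (x * y)) ->
    (forall x, C x -> C x^-1) -> (forall x, V x -> V x^-1) ->
    (forall x, C x -> V x) -> (forall x y, V x -> V y -> C [~ x, y]) ->
  exists (Q : zmodType) (q : G -> Q),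
    (forall x y, V x -> V y -> q (x * y) = (q x + q y)%R) /\
    (forall x, V x -> q x = 0%R <-> C x).
Proof.
move=> V1 VM C1 CM CV VI CsubV Ccomm.
(* Elements outside [V] are sent to 1, which makes the coset relation an equivalence on all of
   [G]. *)
pose n x := if `[< V x >] then x else 1.
have nV x : V (n x) by rewrite /n; case: asboolP.
have nE x : V x -> n x = x by rewrite /n; case: asboolP.
have CJ x y : C x -> V y -> C (x ^ y).
  move=> Cx Vy; have -> : x ^ y = x * [~ x, y] by rewrite commgEl mulVKg.
  by apply: CM => //; apply: Ccomm => //; apply: CsubV.
pose e x y := `[< C ((n x)^-1 * n y) >].
have e_refl : reflexive e by move=> x; apply/asboolP; rewrite mulVg.
have e_sym : symmetric e.
  by move=> x y; apply/asboolP/asboolP => /CV; rewrite invgM invgK.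
have e_trans : transitive e.
  move=> y x z /asboolP xy /asboolP yz; apply/asboolP.
  by have := CM _ _ xy yz; rewrite mulgA mulgK.
pose er := EquivRel e e_refl e_sym e_trans.
pose T : choiceType := {eq_quot er}.
pose p (x : G) : T := \pi_T x.
have pP x y : reflect (C ((n x)^-1 * n y)) (p x == p y).
  by rewrite eqmodE; apply: asboolP.
have pE x y : V x -> V y -> C (x^-1 * y) -> p x = p y.
  by move=> Vx Vy Cxy; apply/eqP/pP; rewrite !nE.
have pM x x' y y' : V x -> V x' -> V y -> V y' -> C (x^-1 * x') -> C (y^-1 * y') ->
    p (x * y) = p (x' * y').
  move=> Vx Vx' Vy Vy' xx' yy'; apply: pE; [exact: VM | exact: VM |].
  have := CM _ _ (CJ _ _ xx' Vy) yy'.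
  by rewrite /conjg invgM !mulgA mulgK.
(* The chosen representative may lie outside [V]; normalizing it by [n] does not change its
   class. *)
pose rp (t : T) : G := n (repr t).
have rpV t : V (rp t) by exact: nV.
have rpK t : p (rp t) = t.
  rewrite -[RHS]reprK; apply/eqP/pP.
  by rewrite /rp (nE (n _)) ?mulVg.
have rpC x : V x -> C ((rp (p x))^-1 * x).
  move=> Vx; have /eqP/pP := rpK (p x).
  by rewrite !nE.
pose add t u : T := p (rp t * rp u).
pose opp t : T := p (rp t)^-1.
have addE x y : V x -> V y -> add (p x) (p y) = p (x * y).
  by move=> Vx Vy; apply: pM => //; apply: rpC.
have addC : commutative add.
  move=> t u; rewrite /add; apply: pE; [exact: VM| exact: VM |].
  by rewrite invgM -!mulgA -commgEl; apply: Ccomm; apply: rpV.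
have addA : associative add.
  move=> s t u; rewrite -(rpK s) -(rpK t) -(rpK u).
  by rewrite !addE ?mulgA //; apply: VM.
have add0 : left_id (p 1) add.
  by move=> t; rewrite -(rpK t) addE // mul1g.
have addN : left_inverse (p 1) opp add.
  move=> t; rewrite -{2}(rpK t) /opp addE ?mulVg //; exact: VI.
pose Q : zmodType := HB.pack T (GRing.isZmodule.Build T addA addC add0 addN).
exists Q, p; split; first by move=> x y Vx Vy; rewrite -addE.
move=> x Vx; split.
  move=> /esym/eqP/pP; rewrite !nE // invg1 mul1g //.
by move=> Cx; apply/esym; apply: pE => //; rewrite invg1 mul1g.
Qed.

End AbelianQuotient.

(** * Finite words, balls and the lexicographic order *)

Section Words.
Variable d : nat.
Implicit Types (w v u z : seq 'I_d) (x y : word d) (s t : {perm 'I_d}).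

Lemma app_cat w z y : app (w ++ z) y = app w (app z y).
Proof.
apply: funext => n; rewrite /app size_cat nth_cat.
case: (ltnP n (size w)) => nw; first by rewrite ltn_addr //; apply: set_nth_default.
rewrite -ltn_subLR // subnDA; case: ifP => // nz; exact: set_nth_default.
Qed.

Lemma app_rcons w a y : app (rcons w a) y = app w (app [:: a] y).
Proof. by rewrite -cats1 app_cat. Qed.

Lemma lact1 y : lact 1%g y = y.
Proof. by apply: funext => n; rewrite /lact perm1. Qed.

Lemma lactM s t y : lact (s * t)%g y = lact t (lact s y).
Proof. by apply: funext => n; rewrite /lact permM. Qed.

Lemma lact_app s w y : lact s (app w y) = app (map s w) (lact s y).
Proof.
apply: funext => n; rewrite /lact /app size_map; case: ifP => // nw.
by rewrite (nth_map (y 0)).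
Qed.

Definition shift k x : word d := fun n => x (n + k).

Lemma shift_app w y : shift (size w) (app w y) = y.
Proof. by apply: funext => n; rewrite /shift /app ltnNge leq_addl addnK. Qed.

Lemma app_inj w : injective (app w : word d -> word d).
Proof. exact: (can_inj (shift_app w)). Qed.

(** Boolean counterpart of [inball], so that coverings can be handled by [count]. *)
Definition inb w x := mkseq x (size w) == w.

Lemma inb_app w y : inb w (app w y).
Proof.
apply/eqP/(@eq_from_nth _ (y 0)); rewrite size_mkseq // => i iw.
by rewrite nth_mkseq // /app iw.
Qed.

Lemma app_shift w x : inb w x -> app w (shift (size w) x) = x.
Proof.
move=> /eqP wx; apply: funext => n; rewrite /app /shift; case: ltnP => nw.
  by rewrite -[X in nth _ X]wx nth_mkseq.
by rewrite subnK.
Qed.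

Lemma inbP w x : reflect (inball w x) (inb w x).
Proof.
apply: (iffP eqP) => [wx n nw|wx]; first by rewrite -[X in nth _ X]wx nth_mkseq.
apply: (@eq_from_nth _ (x 0)); rewrite size_mkseq // => i iw.
by rewrite nth_mkseq // wx //; apply: set_nth_default.
Qed.

Lemma inbE w x : inb w x -> exists y, x = app w y.
Proof. by move=> /app_shift wx; exists (shift (size w) x). Qed.

Lemma inb_rcons w a x : inb (rcons w a) x = inb w x && (x (size w) == a).
Proof. by rewrite /inb size_rcons mkseqS eqseq_rcons. Qed.

Lemma inb_app_cat w z y : inb (w ++ z) (app w y) = inb z y.
Proof.
apply/idP/idP => [/inbE[y']|/inbE[y' ->]]; last by rewrite -app_cat inb_app.
by rewrite app_cat => /app_inj ->; apply: inb_app.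
Qed.

Lemma inb_prefix w v x : prefix w v -> inb v x -> inb w x.
Proof. by move=> /prefixP[z ->] /inbE[y ->]; rewrite app_cat inb_app. Qed.

Lemma inb_size w v x : inb w x -> inb v x -> size w <= size v -> prefix w v.
Proof.
move=> /eqP wx /eqP vx le; apply/prefixP; exists (drop (size w) v).
have -> : w = take (size w) v; last by rewrite size_take_min (minn_idPl le) cat_take_drop.
by rewrite -vx /mkseq -map_take take_iota (minn_idPl le).
Qed.

Lemma inb_size_eq w v x : inb w x -> inb v x -> size w = size v -> w = v.
Proof. by move=> /eqP wx /eqP vx sz; rewrite -wx -vx sz. Qed.

Lemma inb_mkseq x n : inb (mkseq x n) x.
Proof. by rewrite /inb size_mkseq. Qed.

(** Incomparability for the prefix order, that is, disjointness of the two balls. *)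
Definition inc v w := ~~ prefix v w && ~~ prefix w v.

Lemma incC v w : inc v w = inc w v.
Proof. by rewrite /inc andbC. Qed.

Lemma inc_inb v w x : inc v w -> inb v x -> inb w x = false.
Proof.
move=> /andP[vw wv] xv; apply/negP => xw.
case/orP: (leq_total (size v) (size w)) => le.
  by rewrite (inb_size xv xw le) in vw.
by rewrite (inb_size xw xv le) in wv.
Qed.

Lemma inc_catl v w z : inc v w -> inc (v ++ z) w.
Proof.
move=> /andP[vw wv]; apply/andP; split.
  by apply: contraNN vw; apply: catl_prefix.
apply/negP; rewrite prefixE => /eqP E.
case/orP: (leq_total (size v) (size w)) => le.
  by move: vw; rewrite prefixE -E take_takel // take_size_cat // eqxx.
by move: wv; rewrite prefixE -{2}E takel_cat // eqxx.
Qed.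

Lemma inc_catr v w z : inc v w -> inc v (w ++ z).
Proof. by rewrite incC => /inc_catl; rewrite incC. Qed.

Lemma inc_rconsl v w a : inc v w -> inc (rcons v a) w.
Proof. by rewrite -cats1; apply: inc_catl. Qed.

Lemma inc_rconsr v w a : inc v w -> inc v (rcons w a).
Proof. by rewrite -cats1; apply: inc_catr. Qed.

Lemma inc_neq v w : inc v w -> v != w.
Proof. by apply: contraTneq => ->; rewrite /inc prefix_refl. Qed.

Lemma inc_children v a b : inc (rcons v a) (rcons v b) = (a != b).
Proof.
elim: v => [|c v IH]; last by rewrite /inc /= eqxx.
by rewrite /inc /= (eq_sym b); case: eqVneq.
Qed.

Lemma inc_heads a b v w : a != b -> inc (a :: v) (b :: w).
Proof. by move=> ab; rewrite /inc /= (eq_sym b) (negPf ab). Qed.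

Lemma inc_eqsize v w : size v = size w -> v != w -> inc v w.
Proof.
move=> sz vw; apply/andP; split; apply: contraNN vw => /prefixP[z E].
  move: sz; rewrite E size_cat -[LHS]addn0 => /addnI/esym/size0nil ->.
  by rewrite cats0.
move: sz; rewrite E size_cat -[RHS]addn0 => /addnI/size0nil ->.
by rewrite cats0.
Qed.

Lemma lexlt_irr v : lexlt v v = false.
Proof. by elim: v => //= a v ->; rewrite ltnn eqxx. Qed.

Lemma lexlt_total v w : v != w -> lexlt w v = ~~ lexlt v w.
Proof.
elim: v w => [|a v IH] [|b w] //=; rewrite eqseq_cons.
rewrite (eq_sym b); case: (eqVneq a b) => [->|ab] /=; first by rewrite ltnn; apply: IH.
rewrite !orbF -leqNgt [RHS]leq_eqVlt eq_sym.
by have -> : (nat_of_ord a == nat_of_ord b) = false by exact: (negbTE ab).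
Qed.

Lemma lexlt_trans v u w : lexlt v u -> lexlt u w -> lexlt v w.
Proof.
elim: v u w => [|a v IH] [|b u] [|c w] //=.
case/orP=> [ab|/andP[/eqP<- vu]] /orP[bc|/andP[/eqP<- uw]].
- by rewrite (ltn_trans ab bc).
- by rewrite ab.
- by rewrite bc.
- by rewrite eqxx (IH _ _ vu uw) orbT.
Qed.

(** Incomparable words already differ at a position present in both, so further letters cannot
    affect the comparison. This is why a split row keeps its inversions with the other rows. *)
Lemma lexlt_rcons v w a : inc v w -> lexlt (rcons v a) w = lexlt v w.
Proof.
elim: v w => [|b v IH] [|c w] //=.
rewrite /inc /= (eq_sym c); by case: eqVneq => //= -> /IH ->.
Qed.

Lemma lexlt_rconsr v w a : inc v w -> lexlt w (rcons v a) = lexlt w v.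
Proof.
move=> vw; have wv := vw; rewrite incC in wv.
rewrite (lexlt_total (inc_neq (inc_rconsl a vw))) (lexlt_total (inc_neq vw)).
by rewrite lexlt_rcons.
Qed.

Lemma lexlt_children v (a b : 'I_d) : lexlt (rcons v a) (rcons v b) = (a < b).
Proof. by elim: v => [|c v IH] /=; rewrite ?andbF ?orbF // ltnn eqxx. Qed.

End Words.
Arguments inb {d} w x.

Lemma count_le1_inj (T : eqType) (a : pred T) (s : seq T) :
  count a s <= 1 -> {in s &, forall x y, a x -> a y -> x = y}.
Proof.
move=> c1 x y xs ys ax ay; apply/eqP; apply: contraTT c1 => xy.
rewrite -ltnNge (seq.permP (perm_to_rem xs)) /= ax ltnS -has_count.
apply/hasP; exists y => //.
by have := perm_mem (perm_to_rem xs) y; rewrite ys inE eq_sym (negPf xy) => /esym.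
Qed.

Lemma count_le1_uniq (T : eqType) (s : seq T) :
  (forall x, count_mem x s <= 1) -> uniq s.
Proof.
elim: s => //= a s IH c1; apply/andP; split.
  by have := c1 a; rewrite eqxx ltnS leqn0 => /eqP/count_memPn.
by apply: IH => x; apply: leq_trans (c1 x); apply: leq_addl.
Qed.

(** * Tables as lists of rows, their splitting and their existence *)

Section Tables.
Variable d : nat.
Hypothesis hd : 1 < d.
Implicit Types (w v u z : seq 'I_d) (x y : word d) (s t : {perm 'I_d}).

Definition row : Type := seq 'I_d * seq 'I_d * {perm 'I_d}.
Definition src (r : row) := r.1.1.
Definition tgt (r : row) := r.1.2.
Definition lab (r : row) := r.2.
Definition affr (g : word d -> word d) (r : row) :=
  forall y, g (app (src r) y) = app (tgt r) (lact (lab r) y).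
Definition child (r : row) (a : 'I_d) : row :=
  (rcons (src r) a, rcons (tgt r) (lab r a), lab r).
Definition split (r : row) : seq row := [seq child r a | a <- enum 'I_d].

(** One count expresses both covering and disjointness; it is additive under concatenation and blind
    to reordering. *)
Definition part (P : seq (seq 'I_d)) := forall x, count (inb^~ x) P = 1.

Lemma rowE (r : row) : r = (src r, tgt r, lab r).
Proof. by case: r => [[]]. Qed.

Lemma word_inhabited : inhabited (word d).
Proof. by split=> _; apply: (Ordinal (ltnW hd)). Qed.

Lemma part_inc P v w : (forall x, count (inb^~ x) P <= 1) ->
  v \in P -> w \in P -> v != w -> inc v w.
Proof.
move=> c1 vP wP vw; have [y0] := word_inhabited.
apply/andP; split; apply: contraNN vw => pr; apply/eqP.
  apply: (count_le1_inj (c1 (app w y0))) => //; last exact: inb_app.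
  by apply: inb_prefix pr _; apply: inb_app.
apply: (count_le1_inj (c1 (app v y0))) => //; first exact: inb_app.
by apply: inb_prefix pr _; apply: inb_app.
Qed.

Lemma part_uniq P : (forall x, count (inb^~ x) P <= 1) -> uniq P.
Proof.
move=> c1; apply: count_le1_uniq => w; have [y0] := word_inhabited.
apply: leq_trans (c1 (app w y0)); apply: sub_count => _ /eqP ->.
exact: inb_app.
Qed.

Lemma count_enum_eq (a : 'I_d) (p : pred 'I_d) : p =1 pred1 a -> count p (enum 'I_d) = 1.
Proof. by move=> /eq_count ->; rewrite count_uniq_mem ?enum_uniq // mem_enum. Qed.

Lemma count_children v x : count (inb^~ x) [seq rcons v a | a <- enum 'I_d] = inb v x.
Proof.
rewrite count_map; case vx: (inb v x); last first.
  by rewrite -[RHS](count_pred0 (enum 'I_d)); apply: eq_count => a; rewrite /= inb_rcons vx.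
by apply: (count_enum_eq (a := x (size v))) => a; rewrite /= inb_rcons vx eq_sym.
Qed.

Lemma src_split r : map src (split r) = [seq rcons (src r) a | a <- enum 'I_d].
Proof. by rewrite /split -map_comp. Qed.

Lemma tgt_split r : perm_eq (map tgt (split r)) [seq rcons (tgt r) a | a <- enum 'I_d].
Proof.
have -> : map tgt (split r) = [seq rcons (tgt r) a | a <- [seq lab r a | a <- enum 'I_d]].
  by rewrite /split -!map_comp.
apply/perm_map/uniq_perm; rewrite ?enum_uniq //.
  by rewrite map_inj_uniq ?enum_uniq //; apply: perm_inj.
move=> a; rewrite mem_enum; apply/mapP; exists ((lab r)^-1%g a); rewrite ?mem_enum //.
by rewrite permKV.
Qed.

Lemma count_split_src r x : count (inb^~ x) (map src (split r)) = inb (src r) x.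
Proof. by rewrite src_split count_children. Qed.

Lemma count_split_tgt r x : count (inb^~ x) (map tgt (split r)) = inb (tgt r) x.
Proof. by rewrite (seq.permP (tgt_split r)) count_children. Qed.

Lemma affr_child g r a : affr g r -> affr g (child r a).
Proof. by move=> gr y; rewrite /= !app_rcons gr lact_app. Qed.

Lemma affr_merge g r : (forall a, affr g (child r a)) -> affr g r.
Proof.
move=> gr y; have -> : y = app [:: y 0] (shift 1 y).
  by rewrite (@app_shift _ [:: y 0]) // /inb /= .
by rewrite -app_rcons gr /= app_rcons lact_app.
Qed.

(** If one target were shorter, the letter just after it would be the image of the first letter of
    [y] under a permutation on one side, and a fixed letter on the other; two distinct values of
    that first letter give a contradiction. *)
Lemma affr_inj g r r' : affr g r -> affr g r' -> src r = src r' -> r = r'.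
Proof.
move=> gr gr' e; rewrite (rowE r) (rowE r') -e.
have E y : app (tgt r) (lact (lab r) y) = app (tgt r') (lact (lab r') y).
  by rewrite -gr -gr' e.
have le r1 r2 : (forall y, app (tgt r1) (lact (lab r1) y) = app (tgt r2) (lact (lab r2) y)) ->
    size (tgt r2) <= size (tgt r1).
  move=> E1; rewrite leqNgt; apply/negP => lt.
  have /perm_inj/(congr1 val) // : lab r1 (Ordinal (ltnW hd)) = lab r1 (Ordinal hd).
  have F y : lab r1 (y 0) = nth (lab r2 (y 0)) (tgt r2) (size (tgt r1)).
    have /(congr1 (fun f : word d => f (size (tgt r1)))) := E1 y.
    by rewrite /app ltnn lt subnn.
  rewrite (F (fun=> Ordinal (ltnW hd))) (F (fun=> Ordinal hd)).
  exact: set_nth_default.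
have sz : size (tgt r) = size (tgt r').
  by apply/eqP; rewrite eqn_leq !le.
have [y0] := word_inhabited.
have et : tgt r = tgt r'.
  apply: inb_size_eq sz; first exact: inb_app (lact (lab r) y0).
  by rewrite E; apply: inb_app.
rewrite -et; congr (_, _, _); apply/permP => a.
have := E (fun=> a); rewrite -et => /app_inj/(congr1 (@^~ 0)) //.
Qed.

Variable H : {group {perm 'I_d}}.

(** The rows come in no particular order: inversions compare the words themselves, and sorting is
    postponed until tables in the sense of the statement are produced. *)
Definition istable (g : word d -> word d) (T : seq row) :=
  [/\ part (map src T), part (map tgt T) & forall r, r \in T -> lab r \in H /\ affr g r].

Definition refine (p : pred row) (T : seq row) : seq row :=
  flatten [seq if p r then split r else [:: r] | r <- T].

Lemma count_refine p T x (f : row -> seq 'I_d) :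
  (forall r, count (inb^~ x) (map f (split r)) = inb (f r) x) ->
  count (inb^~ x) (map f (refine p T)) = count (inb^~ x) (map f T).
Proof.
move=> fs; rewrite /refine; elim: T => //= r T IH.
by rewrite map_cat count_cat IH; case: (p r); rewrite ?fs //= addn0.
Qed.

Lemma refineP p T r : r \in refine p T ->
  (r \in T /\ ~~ p r) \/ exists r' a, [/\ r' \in T, p r' & r = child r' a].
Proof.
case/flatten_mapP=> r' r'T; case: ifP => [pr /mapP[a _ ->]|pr].
  by right; exists r', a.
by rewrite inE => /eqP ->; left; rewrite pr.
Qed.

Lemma istable_refine p g T : istable g T -> istable g (refine p T).
Proof.
move=> [ps pt gT]; split.
- by move=> x; rewrite count_refine // => r; apply: count_split_src.
- by move=> x; rewrite count_refine // => r; apply: count_split_tgt.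
move=> r /refineP[[/gT//]|[r' [a [/gT[Hr gr] _ ->]]]]; split=> //.
exact: affr_child.
Qed.

Lemma istable_perm g T T' : perm_eq T T' -> istable g T -> istable g T'.
Proof.
move=> TT' [ps pt gT]; split=> [x|x|r].
- by rewrite -(ps x); apply/esym/seq.permP/perm_map.
- by rewrite -(pt x); apply/esym/seq.permP/perm_map.
by rewrite -(perm_mem TT'); apply: gT.
Qed.

(** The targets are the images of the sources under a bijection, so they form a partition as soon as
    the sources do. *)
Lemma istable_intro g T : bijective g -> part (map src T) ->
  (forall r, r \in T -> lab r \in H /\ affr g r) -> istable g T.
Proof.
case=> gi gK giK ps gT; split=> // x.
rewrite -(ps (gi x)) !count_map; apply: eq_in_count => r /gT[_ gr] /=.
rewrite -[in LHS](giK x); apply/idP/idP => /inbE[y E]; last first.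
  by rewrite E gr inb_app.
have -> : gi x = app (src r) (lact ((lab r)^-1)%g y); last exact: inb_app.
by apply: (can_inj gK); rewrite E gr -lactM mulVg lact1.
Qed.

Lemma inV_bij g : inV H g -> bijective g.
Proof. by case=> -[gi [gK giK]] _; exists gi. Qed.

(* Compactness of A^omega, as Koenig's lemma: an infinite branch of balls none of
   which carries a finite table would converge to a point without local form. *)
Lemma exists_table g : inV H g -> exists T, istable g T.
Proof.
move=> Vg; have [_ loc] := Vg.
pose good w := exists T, (forall x, count (inb^~ x) (map src T) = inb w x) /\
  forall r, r \in T -> lab r \in H /\ affr g r.
suff [T [cT gT]] : good [::].
  by exists T; apply: istable_intro => //; apply: inV_bij.
have step w : (forall a, good (rcons w a)) -> good w.
  move=> gw; suff [T [cT gT]] : exists T,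
      (forall x, count (inb^~ x) (map src T) = count (inb^~ x) [seq rcons w a | a <- enum 'I_d]) /\
      forall r, r \in T -> lab r \in H /\ affr g r.
    by exists T; split=> // x; rewrite cT count_children.
  elim: (enum 'I_d) => [|a l [T [cT gT]]]; first by exists [::].
  have [Ta [cTa gTa]] := gw a; exists (Ta ++ T); split=> [x|r].
    by rewrite map_cat count_cat cT cTa.
  by rewrite mem_cat => /orP[/gTa|/gT].
apply: contrapT => bad0.
have bad_step w : ~ good w -> exists a, ~ good (rcons w a).
  move=> bw; apply: contrapT => nex; apply/bw/step => a.
  by apply: contrapT => na; apply: nex; exists a.
pose next w := if pselect (~ good w) is left bw then sval (cid (bad_step w bw))
               else Ordinal (ltnW hd).
pose pre n := iter n (fun w => rcons w (next w)) [::].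
have bad n : ~ good (pre n).
  elim: n => //= n IH; rewrite /next; case: pselect => // bw.
  exact: (svalP (cid (bad_step _ bw))).
have szpre n : size (pre n) = n by elim: n => //= n IH; rewrite size_rcons IH.
pose x : word d := fun n => next (pre n).
have preE n : pre n = mkseq x n.
  by elim: n => //= n IH; rewrite mkseqS -IH.
have [w1 [w2 [s [Hs /inbP/eqP w1x gw]]]] := loc x.
apply: (bad (size w1)); rewrite preE w1x.
exists [:: (w1, w2, s)]; split=> [y|r]; first by rewrite /= addn0.
by rewrite inE => /eqP ->; split.
Qed.

Lemma istable_inV g T : bijective g -> istable g T -> inV H g.
Proof.
move=> [gi gK giK] [ps _ gT]; split; first by exists gi.
move=> x; have : has (inb^~ x) (map src T) by rewrite has_count ps.
case/hasP=> v /mapP[r rT ->] /inbP rx; have [Hr gr] := gT r rT.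
by exists (src r), (tgt r), (lab r).
Qed.

End Tables.

Arguments src {d} r.
Arguments tgt {d} r.
Arguments lab {d} r.

(** * Inversion sums and the sign of a permutation *)

Section InversionSums.
Variables (Q : zmodType) (eps : Q).
Hypothesis eps2 : (eps *+ 2 = 0)%R.
Local Open Scope ring_scope.

(** The induction removes a row and a column together, which avoids dividing by 2: [Q] may have
    2-torsion. *)
Lemma skew_sum (I : eqType) (T : seq I) (D : I -> I -> Q) :
  {in T, forall x, D x x = 0} -> {in T &, forall x y, D x y + D y x = 0} ->
  \sum_(x <- T) \sum_(y <- T) D x y = 0.
Proof.
elim: T => [|x T IH] D0 DD; first by rewrite big_nil.
rewrite big_cons big_cons D0 ?mem_head // add0r.
under [X in _ + X]eq_bigr do rewrite big_cons.
rewrite big_split /= IH ?addr0.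
- rewrite -big_split /= big_seq big1 // => y yT.
  by rewrite DD // ?mem_head // inE yT orbT.
- by move=> y yT; apply: D0; rewrite inE yT orbT.
by move=> y z yT zT; apply: DD; rewrite inE ?yT ?zT orbT.
Qed.

Lemma eps_addb (a b : bool) : eps *+ (a (+) b) = eps *+ a + eps *+ b.
Proof. by case: a b => [] []; rewrite /= ?mulr0n ?addr0 ?add0r // -mulr2n eps2. Qed.

Lemma eps_opp (a : bool) : - (eps *+ a) = eps *+ a.
Proof. by apply/eqP; rewrite eq_sym -addr_eq0 -eps_addb addbb. Qed.

(** For each unordered pair, the first and third orders disagree exactly when one, and only one, of
    the two intermediate comparisons disagrees; modulo 2 the disagreements add up. *)
Lemma inversions_comp (I : eqType) (T : seq I) (lt1 lt2 lt3 : rel I) :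
  (forall x, [&& ~~ lt1 x x, ~~ lt2 x x & ~~ lt3 x x]) ->
  {in T &, forall x y, x != y ->
    [/\ lt1 y x = ~~ lt1 x y, lt2 y x = ~~ lt2 x y & lt3 y x = ~~ lt3 x y]} ->
  \sum_(x <- T) \sum_(y <- T) eps *+ (lt1 x y && lt3 y x) =
  \sum_(x <- T) \sum_(y <- T) eps *+ (lt1 x y && lt2 y x) +
  \sum_(x <- T) \sum_(y <- T) eps *+ (lt2 x y && lt3 y x).
Proof.
move=> irr tot; apply/eqP; rewrite -subr_eq0 opprD addrA -!sumrB; apply/eqP.
under eq_bigr do rewrite -!sumrB.
apply: skew_sum => [x _|x y xT yT].
  by have /and3P[/negPf-> /negPf-> /negPf->] := irr x; rewrite !subr0.
case: (eqVneq x y) => [->|/tot].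
  by have /and3P[/negPf-> /negPf-> /negPf->] := irr y; rewrite /= !subr0 addr0.
case=> // -> -> ->; rewrite !eps_opp -!eps_addb.
by case: (lt1 x y) (lt2 x y) (lt3 x y) => [] [] [].
Qed.

Definition pinv n (s : 'S_n) : Q :=
  \sum_(a <- enum 'I_n) \sum_(b <- enum 'I_n) eps *+ ((a < b)%N && (s b < s a)%N).

Lemma ord_lt_total n (a b : 'I_n) : a != b -> (b < a)%N = ~~ (a < b)%N.
Proof. by move=> ab; rewrite -leqNgt [RHS]leq_eqVlt eq_sym -[_ == _ :> nat]/(a == b) (negPf ab). Qed.

Lemma pinvM n (s t : 'S_n) : pinv (s * t)%g = pinv s + pinv t.
Proof.
pose lt1 (a b : 'I_n) := (a < b)%N; pose lt2 a b := lt1 (s a) (s b).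
pose lt3 a b := lt1 ((s * t)%g a) ((s * t)%g b).
rewrite /pinv (@inversions_comp _ _ lt1 lt2 lt3); first last.
- move=> a b _ _ ab; rewrite /lt2 /lt3 /lt1.
  by split; apply: ord_lt_total; rewrite ?(inj_eq perm_inj).
- by move=> a; rewrite /lt3 /lt2 /lt1 !ltnn.
congr (_ + _); rewrite !big_enum [RHS](reindex_inj (@perm_inj _ s)) /=.
apply: eq_bigr => a _; rewrite !big_enum [RHS](reindex_inj (@perm_inj _ s)) /=.
by apply: eq_bigr => b _; rewrite /lt2 /lt3 /lt1 !permM.
Qed.

Lemma pinv1 n : pinv (1 : 'S_n)%g = 0.
Proof. by have /eqP := pinvM (1 : 'S_n)%g 1%g; rewrite mulg1 -subr_eq0 opprD addNKr oppr_eq0 => /eqP. Qed.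

Lemma pinvJ n (s t : 'S_n) : pinv (s ^ t)%g = pinv s.
Proof.
have V : pinv t^-1%g + pinv t = 0 by rewrite -pinvM mulVg pinv1.
by rewrite /conjg !pinvM addrCA V addr0.
Qed.

Lemma pinv_tperm01 n : pinv (tperm (inord 0) (inord 1) : 'S_n.+2) = eps.
Proof.
set i0 := inord 0; set i1 := inord 1.
have v0 : i0 = 0%N :> nat by rewrite inordK.
have v1 : i1 = 1%N :> nat by rewrite inordK.
have tv (b : 'I_n.+2) : tperm i0 i1 b = (if b == i0 then 1 else if b == i1 then 0 else b)%N :> nat.
  case: tpermP => [->|->|/eqP b0 /eqP b1]; rewrite ?v0 ?v1 ?eqxx //.
    by case: eqP => // /(congr1 val); rewrite /= v0 v1.
  by rewrite (negPf b0) (negPf b1).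
have E (a b : 'I_n.+2) :
    (a < b)%N && (tperm i0 i1 b < tperm i0 i1 a)%N = (a == i0) && (b == i1).
  have eqn (x y : 'I_n.+2) : (x == y) = (val x == val y) by [].
  rewrite !tv !eqn /= v0 v1.
  case: (nat_of_ord a) (nat_of_ord b) => [|[|m]] [|[|k]] //=.
  by case: ltngtP.
rewrite /pinv big_enum (bigD1 i0) //= big_enum (bigD1 i1) //= E !eqxx.
rewrite big1 ?addr0 => [|b b1]; last by rewrite E (negPf b1) andbF.
rewrite big1 ?addr0 // => a a0; rewrite big1_seq // => b _.
by rewrite E (negPf a0).
Qed.

(** [odd_perm] is defined by counting cycles, so the link with inversions goes through generators:
    [pinv] is additive and conjugation invariant, and the transposition of 0 and 1 has a single
    inversion. *)
Lemma pinv_odd n (s : 'S_n) : pinv s = eps *+ odd_perm s.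
Proof.
have [ts -> /=] := prod_tpermP s.
elim: ts => [|[x y] ts IH] /=; first by rewrite big_nil pinv1 odd_perm1.
case/andP; rewrite /dpair /= => xy /IH{}IH.
rewrite big_cons pinvM odd_permM odd_tperm xy eps_addb IH; congr (_ + _).
case: n => [|[|n]] in x y xy {IH ts s} *; first by case: (x).
  by rewrite !ord1 eqxx in xy.
have n01 : inord 0 != inord 1 :> 'I_n.+2 by apply/negP => /eqP/(congr1 val); rewrite /= !inordK.
(* [p1] brings 0 to [x]; [p2] then brings the image of 1 to [y] and leaves [x] alone. *)
pose p1 := tperm (inord 0) x; pose p2 := tperm (p1 (inord 1)) y.
have -> : tperm x y = (tperm (inord 0) (inord 1) ^ (p1 * p2))%g.
  rewrite tpermJ !permM tpermL [p2 (p1 (inord 1))]tpermL [p2 x]tpermD //; last by rewrite eq_sym.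
  by rewrite -[X in _ != X](tpermL (inord 0) x) (inj_eq perm_inj) eq_sym.
by rewrite pinvJ pinv_tperm01.
Qed.

End InversionSums.

(** * The invariant of a table and its additivity *)

Section Value.
Variable d : nat.
Hypothesis hd : 1 < d.
Variable H : {group {perm 'I_d}}.
Variables (Q : zmodType) (eta : {perm 'I_d} -> Q) (eps : Q).
Hypothesis etaM : {in H &, forall s t, eta (s * t)%g = (eta s + eta t)%R}.
Hypothesis eps2 : (eps *+ 2 = 0)%R.
Hypothesis epsd : (eps *+ d = eps)%R.
Hypothesis etad : {in H, forall s, (eta s *+ d.-1 = eps *+ odd_perm s)%R}.
Implicit Types (g f : word d -> word d) (r : row d) (T : seq (row d)).
Local Open Scope ring_scope.

Definition inversion r r' := lexlt (src r) (src r') && lexlt (tgt r') (tgt r).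

Definition pairsum T T' : Q := \sum_(r <- T) \sum_(r' <- T') eps *+ inversion r r'.

(** The labels contribute through [eta]; the double sum is [eps] times the number of inversions
    between the lexicographic orders of sources and targets. *)
Definition value T : Q := \sum_(r <- T) eta (lab r) + pairsum T T.

Lemma value_perm T T' : perm_eq T T' -> value T = value T'.
Proof.
move=> TT'; rewrite /value /pairsum (perm_big _ TT') /=; congr (_ + _).
rewrite (perm_big _ TT') /=; apply: eq_bigr => r _; exact: perm_big.
Qed.

Lemma pairsum_catl T1 T2 T : pairsum (T1 ++ T2) T = pairsum T1 T + pairsum T2 T.
Proof. by rewrite /pairsum big_cat. Qed.

Lemma pairsum_catr T1 T2 T : pairsum T (T1 ++ T2) = pairsum T T1 + pairsum T T2.
Proof. by rewrite /pairsum -big_split; apply: eq_bigr => r _; rewrite big_cat. Qed.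

Lemma value_cat T1 T2 :
  value (T1 ++ T2) = value T1 + value T2 + (pairsum T1 T2 + pairsum T2 T1).
Proof.
rewrite /value big_cat pairsum_catl !pairsum_catr /=.
rewrite [X in _ = X + _]addrACA -[RHS]addrA; congr (_ + _).
by rewrite [pairsum T2 T1 + _]addrC addrACA.
Qed.

Definition disjoint_rows T :=
  [/\ forall x, (count (inb^~ x) (map src T) <= 1)%N,
      forall x, (count (inb^~ x) (map tgt T) <= 1)%N &
      {in T, forall r, lab r \in H}].

Lemma istable_disjoint g T : istable H g T -> disjoint_rows T.
Proof. by case=> ps pt gT; split=> [x|x|r /gT[]//]; rewrite ?ps ?pt. Qed.

Lemma disjoint_rows_perm T T' : perm_eq T T' -> disjoint_rows T -> disjoint_rows T'.
Proof.
move=> TT' [ps pt gT]; split=> [x|x|r].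
- by have /seq.permP <- := perm_map src TT'.
- by have /seq.permP <- := perm_map tgt TT'.
by rewrite -(perm_mem TT'); apply: gT.
Qed.

Lemma disjoint_rows_src T r r' : disjoint_rows T -> r \in T -> r' \in T -> r != r' ->
  src r != src r'.
Proof.
move=> [ps _ _] rT r'T; apply: contra_neq => e; have [y0] := word_inhabited hd.
apply: (count_le1_inj (s := T) (a := fun r => inb (src r) (app (src r') y0))) => //.
- by have := ps (app (src r') y0); rewrite count_map.
- by rewrite e inb_app.
exact: inb_app.
Qed.

Lemma disjoint_rows_tgt T r r' : disjoint_rows T -> r \in T -> r' \in T -> r != r' ->
  tgt r != tgt r'.
Proof.
move=> [_ pt _] rT r'T; apply: contra_neq => e; have [y0] := word_inhabited hd.
apply: (count_le1_inj (s := T) (a := fun r => inb (tgt r) (app (tgt r') y0))) => //.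
- by have := pt (app (tgt r') y0); rewrite count_map.
- by rewrite e inb_app.
exact: inb_app.
Qed.

Lemma disjoint_rows_cons r T r' : disjoint_rows (r :: T) -> r' \in T ->
  inc (src r) (src r') /\ inc (tgt r) (tgt r').
Proof.
move=> [ps pt _] r'T; split.
  apply: (part_inc hd ps); rewrite ?inE ?eqxx // ?map_f ?orbT //.
  by have := part_uniq hd ps => /= /andP[/memPn nr _]; rewrite eq_sym nr ?map_f.
apply: (part_inc hd pt); rewrite ?inE ?eqxx // ?map_f ?orbT //.
by have := part_uniq hd pt => /= /andP[/memPn nr _]; rewrite eq_sym nr ?map_f.
Qed.

Lemma eps_d (b : bool) : eps *+ b *+ d = eps *+ b.
Proof. by rewrite mulrnAC epsd. Qed.

(** An inversion of [r] with another row is repeated d times, which [epsd] absorbs. The children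
    have inversions among themselves according to the sign of the label, and the labels grow by
    (d-1) times [eta]; by [etad] these two terms are equal, and they cancel by [eps2]. *)
Lemma value_split r T : disjoint_rows (r :: T) -> value (split r ++ T) = value (r :: T).
Proof.
move=> dT; have /(_ _ (mem_head _ _)) Hr : {in r :: T, forall r, lab r \in H} by case: dT.
have vc r' a : r' \in T -> inversion (child r a) r' = inversion r r'.
  move=> /(disjoint_rows_cons dT)[si ti].
  by rewrite /inversion /= lexlt_rcons // lexlt_rconsr.
have vc' r' a : r' \in T -> inversion r' (child r a) = inversion r' r.
  move=> /(disjoint_rows_cons dT)[si ti].
  by rewrite /inversion /= lexlt_rconsr // lexlt_rcons.
have card_d (x : Q) : \sum_(a <- enum 'I_d) x = x *+ d.
  by rewrite big_enum sumr_const card_ord.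
rewrite value_cat -[r :: T]cat1s value_cat; congr (_ + _ + (_ + _)).
- have pr : pairsum [:: r] [:: r] = 0.
    by rewrite /pairsum !big_seq1 /inversion !lexlt_irr mulr0n.
  have ps : pairsum (split r) (split r) = pinv eps (lab r).
    rewrite /pairsum big_map; apply: eq_bigr => a _; rewrite big_map.
    by apply: eq_bigr => b _; rewrite /inversion /= !lexlt_children.
  have es : \sum_(r' <- split r) eta (lab r') = eta (lab r) *+ d.
    by rewrite big_map; exact: (card_d (eta (lab r))).
  rewrite /value pr ps es big_seq1 addr0.
  have -> : eta (lab r) *+ d = eta (lab r) + eta (lab r) *+ d.-1.
    by rewrite -mulrS prednK // ltnW.
  rewrite pinv_odd // etad // -addrA -eps_addb //.
  by rewrite addbb mulr0n addr0.
- rewrite /pairsum big_seq1 big_map.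
  transitivity (\sum_(a <- enum 'I_d) \sum_(r' <- T) eps *+ inversion r r').
    by apply: eq_bigr => a _; rewrite big_seq [RHS]big_seq; apply: eq_bigr => r' /vc ->.
  rewrite (card_d (\sum_(r' <- T) eps *+ inversion r r')) -sumrMnl.
  by apply: eq_bigr => r' _; apply: eps_d.
rewrite /pairsum !big_seq; apply: eq_bigr => r' r'T; rewrite big_seq1 big_map.
rewrite -[RHS]eps_d -card_d.
by apply: eq_bigr => a _; rewrite vc'.
Qed.

Lemma disjoint_rows_refine p T T' :
  disjoint_rows (T ++ T') -> disjoint_rows (refine p T ++ T').
Proof.
move=> [ps pt lH]; split=> [x|x|r].
- have := ps x; rewrite !map_cat !count_cat count_refine // => r.
  exact: count_split_src.
- have := pt x; rewrite !map_cat !count_cat count_refine // => r.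
  exact: count_split_tgt.
rewrite mem_cat => /orP[/refineP[[rT _]|[r' [a [r'T _ ->]]]]|rT'].
- by apply: lH; rewrite mem_cat rT.
- by apply: (lH r'); rewrite mem_cat r'T.
by apply: lH; rewrite mem_cat rT' orbT.
Qed.

(** The extra tail carries the induction: the head row waits in it while the others are refined, and
    is split last. *)
Lemma value_refine_cat p T T' :
  disjoint_rows (T ++ T') -> value (refine p T ++ T') = value (T ++ T').
Proof.
elim: T T' => //= r T IH T' dT.
have mv (X : seq (row d)) : perm_eq (X ++ r :: T') (r :: X ++ T').
  by rewrite -cat1s perm_catCA.
have dT1 : disjoint_rows (T ++ r :: T') by apply: disjoint_rows_perm dT; rewrite perm_sym mv.
have dT2 := disjoint_rows_perm (mv _) (disjoint_rows_refine p dT1).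
rewrite -(value_perm (mv T)) -IH // (value_perm (mv _)) /refine /= -catA.
by case: (p r) => //; rewrite value_split.
Qed.

Lemma value_refine p T : disjoint_rows T -> value (refine p T) = value T.
Proof. by move=> dT; rewrite -[refine p T]cats0 value_refine_cat cats0. Qed.

Lemma istable_iter_refine g p n T : istable H g T ->
  istable H g (iter n (refine p) T) /\ value (iter n (refine p) T) = value T.
Proof.
move=> gT; elim: n => //= n [gn <-]; split; first exact: istable_refine.
by apply/value_refine/(istable_disjoint gn).
Qed.

Lemma iter_refine_size N n T : {in T, forall r, size (src r) <= N}%N ->
  {in iter n (refine (fun r => size (src r) < N)%N) T,
    forall r, minn n N <= size (src r) <= N}%N.
Proof.
move=> TN; elim: n => [r /TN -> //|n IH r /=]; first by rewrite min0n.
case/refineP=> [[rT]|[r' [a [/IH/andP[le _] lt ->]]]].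
  rewrite -leqNgt => ge; have /andP[_ le] := IH r rT.
  by rewrite le andbT (leq_trans (geq_minr _ _) ge).
rewrite /child /src /= size_rcons in lt *.
move: le; rewrite !geq_min !ltnS lt andbT => /orP[->//|le].
by rewrite ltnNge le in lt.
Qed.

(** Both tables refine, without change of value, to tables whose sources all have the same length
    [N]; such a table is determined by [g] up to order. Since each pass lengthens every short source
    by one letter, [N] passes suffice. *)
Lemma value_unique g T T' : istable H g T -> istable H g T' -> value T = value T'.
Proof.
move=> gT gT'; pose N := foldr maxn 0%N [seq size (src r) | r <- T ++ T'].
have leN r : r \in T ++ T' -> (size (src r) <= N)%N.
  rewrite /N; elim: (T ++ T') => //= r' T1 IH; rewrite inE leq_max.
  by case/predU1P => [->|/IH ->]; rewrite ?leqnn ?orbT.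
pose p r := (size (src r) < N)%N.
have [g1 <-] := istable_iter_refine p N gT.
have [g2 <-] := istable_iter_refine p N gT'.
have sz1 : {in iter N (refine p) T, forall r, size (src r) = N}.
  move=> r /iter_refine_size; rewrite minnn => /(_ _)/anti_leq -> // r' r'T.
  by apply: leN; rewrite mem_cat r'T.
have sz2 : {in iter N (refine p) T', forall r, size (src r) = N}.
  move=> r /iter_refine_size; rewrite minnn => /(_ _)/anti_leq -> // r' r'T.
  by apply: leN; rewrite mem_cat r'T orbT.
move: (iter _ _ _) (iter _ _ _) g1 g2 sz1 sz2 => T1 T2 g1 g2 sz1 sz2.
have sub X Y : istable H g X -> istable H g Y -> {in X, forall r, size (src r) = N} ->
    {in Y, forall r, size (src r) = N} -> {subset X <= Y}.
  move=> [_ _ gX] [pY _ gY] szX szY r rX; have [y0] := word_inhabited hd.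
  have : has (inb^~ (app (src r) y0)) (map src Y) by rewrite has_count pY.
  case/hasP=> _ /mapP[r' r'Y ->] /= r'r.
  have e : src r = src r'.
    apply: (@inb_size_eq _ _ _ (app (src r) y0)) => //; first exact: inb_app.
    by rewrite szX ?szY.
  by rewrite (affr_inj hd (gX r rX).2 (gY r' r'Y).2 e).
have uniqT X : istable H g X -> uniq X.
  by case=> pX _ _; apply: (@map_uniq _ _ src); apply: (part_uniq hd) => x; rewrite pX.
apply/value_perm/uniq_perm; [exact: uniqT|exact: uniqT|] => r.
by apply/idP/idP; apply: sub.
Qed.

(** The value of any table of [g]; 0 is a default for maps without a table. *)
Definition phi g : Q :=
  if pselect (exists T, istable H g T) is left ex then value (sval (cid ex)) else 0.

Lemma phiE g T : istable H g T -> phi g = value T.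
Proof.
move=> gT; rewrite /phi; case: pselect => [ex|[]]; last by exists T.
exact: value_unique (svalP (cid ex)) gT.
Qed.

Lemma row_on_ball f T u : istable H f T -> {in T, forall r, size (src r) <= size u}%N ->
  exists r, [/\ src r = u, lab r \in H & affr f r].
Proof.
move=> [pT _ fT] le; have [y0] := word_inhabited hd.
have : has (inb^~ (app u y0)) (map src T) by rewrite has_count pT.
case/hasP=> _ /mapP[r rT ->] /= ru; have [Hr fr] := fT r rT.
have /prefixP[z uE] := inb_size ru (inb_app u y0) (le r rT).
exists (u, tgt r ++ map (lab r) z, lab r); split=> // y.
by rewrite /src /tgt /lab /= uE !app_cat fr lact_app.
Qed.

(** The table of [g] is refined until [f] is given by a single row on each target ball. The
    composite then has a table with the same sources, in which labels multiply and inversions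
    compose. *)
Lemma phiM g f : inV H g -> inV H f -> phi (f \o g) = phi g + phi f.
Proof.
move=> Vg Vf; have [Tg0 gT0] := exists_table hd Vg; have [Tf fT] := exists_table hd Vf.
pose N := foldr maxn 0%N [seq size (src r) | r <- Tf].
have leN : {in Tf, forall r, size (src r) <= N}%N.
  rewrite /N; elim: Tf {fT N} => //= r' T1 IH r; rewrite inE leq_max.
  by case/predU1P => [->|/IH ->]; rewrite ?leqnn ?orbT.
have [gT _] := istable_iter_refine xpredT N gT0.
(* Each pass splits every row, so after [N] passes no target is shorter than a source of [f]. *)
have szT : {in iter N (refine xpredT) Tg0, forall r, N <= size (tgt r)}%N.
  elim: (N) => //= n IH r /refineP[[]//|[r' [a [/IH le _ ->]]]].
  by rewrite /tgt /= size_rcons.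
move: (iter _ _ _) gT szT => T gT szT.
have /choice[F FP] : forall r, exists r', r \in T ->
    [/\ src r' = tgt r, lab r' \in H & affr f r'].
  move=> r; have [rT|] := boolP (r \in T); last by exists r.
  have [|r' r'P] := @row_on_ball f Tf (tgt r) fT.
    by move=> r1 /leN le; apply: leq_trans le (szT r rT).
  by exists r'.
have Fsrc r : r \in T -> src (F r) = tgt r by case/FP.
have fF : istable H f (map F T).
  apply: istable_intro => [|x|_ /mapP[r rT ->]]; first exact: inV_bij Vf.
    have [_ pt _] := gT; rewrite -(pt x) -map_comp !count_map; apply: eq_in_count => r rT.
    by rewrite /= Fsrc.
  by have [_ ? ?] := FP r rT.
pose comp r : row d := (src r, tgt (F r), (lab r * lab (F r))%g).
have fgT : istable H (f \o g) (map comp T).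
  apply: istable_intro => [|x|_ /mapP[r rT ->]].
  - by apply: bij_comp; [apply: inV_bij Vf | apply: inV_bij Vg].
  - by have [ps _ _] := gT; rewrite -(ps x) -map_comp.
  have [_ _ /(_ r rT)[Hr gr]] := gT; have [e HF fFr] := FP r rT.
  by split=> [|y]; rewrite ?groupM // /comp /= gr lactM -fFr e.
rewrite (phiE gT) (phiE fF) (phiE fgT) /value /pairsum !big_map.
have [_ _ gTl] := gT.
have -> : \sum_(r <- T) eta (lab (comp r)) = \sum_(r <- T) eta (lab r) + \sum_(r <- T) eta (lab (F r)).
  rewrite -big_split big_seq [RHS]big_seq; apply: eq_bigr => r rT /=.
  by rewrite etaM //; [case: (gTl r rT) | have [] := FP r rT].
rewrite -!addrA; congr (_ + _); rewrite [RHS]addrCA; congr (_ + _).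
under eq_bigr do rewrite big_map.
under [X in _ = _ + X]eq_bigr do rewrite big_map.
(* The three orders on the rows: by source, by intermediate ball and by final target. *)
pose lt1 r r' := lexlt (src r) (src r'); pose lt2 r r' := lexlt (tgt r) (tgt r').
pose lt3 r r' := lexlt (tgt (F r)) (tgt (F r')).
rewrite (@inversions_comp _ _ eps2 _ _ lt1 lt2 lt3).
- congr (_ + _); rewrite big_seq [RHS]big_seq; apply: eq_bigr => r rT.
  rewrite big_seq [RHS]big_seq; apply: eq_bigr => r' r'T.
  by rewrite /inversion !Fsrc.
- by move=> r; rewrite /lt1 /lt2 /lt3 !lexlt_irr.
move=> r r' rT r'T rr'; have dT := istable_disjoint gT; have dF := istable_disjoint fF.
split; apply: lexlt_total; first exact: disjoint_rows_src dT _ _ _.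
  exact: disjoint_rows_tgt dT _ _ _.
apply: (disjoint_rows_tgt dF); rewrite ?map_f //.
apply: contra_neq (disjoint_rows_tgt dT rT r'T rr') => e.
by rewrite -(Fsrc _ rT) -(Fsrc _ r'T) e.
Qed.

End Value.

(** * The group of bijections of infinite words *)

Section Bijections.
Variable d : nat.

(** The inverse is stored to make inversion a plain projection; by [wbijP] it adds no
    information. *)
Record wbij := Wbij {
  wfun :> word d -> word d;
  winv : word d -> word d;
  wfunK : cancel wfun winv;
  winvK : cancel winv wfun }.

Lemma wbijP (f g : wbij) : wfun f =1 wfun g -> f = g.
Proof.
case: f g => [f fi fK fiK] [g gi gK giK] /= /funext efg.
have efgi : fi = gi by apply: funext => x; rewrite -{1}(giK x) -efg fK.
by move: fK fiK gK giK; rewrite -efg -efgi => *; congr Wbij; apply: Prop_irrelevance.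
Qed.

Definition wbij1 : wbij := @Wbij id id (fun=> erefl) (fun=> erefl).
Definition wbijV (f : wbij) : wbij := Wbij (@winvK f) (@wfunK f).
(* The order of the factors is that of permutations: [f] acts first. *)
Definition wbijM (f g : wbij) : wbij :=
  @Wbij (g \o f) (winv f \o winv g) (can_comp (@wfunK g) (@wfunK f))
        (can_comp (@winvK f) (@winvK g)).

Fact wbijMA : associative wbijM. Proof. by move=> f g h; apply: wbijP. Qed.
Fact wbij1M : left_id wbij1 wbijM. Proof. by move=> f; apply: wbijP. Qed.
Fact wbijM1 : right_id wbij1 wbijM. Proof. by move=> f; apply: wbijP. Qed.
Fact wbijVM : left_inverse wbij1 wbijV wbijM.
Proof. by move=> f; apply: wbijP => x; apply: winvK. Qed.
Fact wbijMV : right_inverse wbij1 wbijV wbijM.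
Proof. by move=> f; apply: wbijP => x; apply: wfunK. Qed.

HB.instance Definition _ := gen_eqMixin wbij.
HB.instance Definition _ := gen_choiceMixin wbij.
HB.instance Definition _ := isGroup.Build wbij wbijMA wbij1M wbijM1 wbijVM wbijMV.

Lemma wbij_bij (f : wbij) : bijective f.
Proof. by exists (winv f); [apply: wfunK | apply: winvK]. Qed.

Lemma wmulE (f g : wbij) x : (f * g)%g x = g (f x).
Proof. by []. Qed.

Lemma wbij_affrV (f : wbij) v u s :
  affr f (v, u, s) -> affr (f^-1)%g (u, v, s^-1)%g.
Proof.
move=> fr y; rewrite -[in LHS](lact1 y) -(mulVg s) lactM -fr.
exact: wfunK.
Qed.

Lemma wbij_affrM (f g : wbij) v u w s t :
  affr f (v, u, s) -> affr g (u, w, t) -> affr (f * g)%g (v, w, s * t)%g.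
Proof. by move=> fr gr y; rewrite wmulE fr gr /src /tgt /lab /= lactM. Qed.

Lemma affr_cat (g : word d -> word d) v u s z :
  affr g (v, u, s) -> affr g (v ++ z, u ++ map s z, s).
Proof. by move=> gr y; rewrite /= !app_cat gr lact_app. Qed.

Lemma wbij_inb (f : wbij) v u s x : affr f (v, u, s) -> inb u (f x) = inb v x.
Proof.
move=> fr; apply/idP/idP => /inbE[y E]; last by rewrite E fr inb_app.
by rewrite -(wfunK f x) E -[winv f _]/((f^-1)%g (app u y)) (wbij_affrV fr) inb_app.
Qed.

End Bijections.

(** * Closure of V_d(H) under the group operations *)

Section VGroup.
Variable d : nat.
Variable H : {group {perm 'I_d}}.
Implicit Types f g : wbij d.

Lemma inV1 : inV H (1%g : wbij d).
Proof.
split=> [|x]; first by exists id.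
by exists [::], [::], 1%g; split=> [|//|y]; rewrite ?group1 // lact1.
Qed.

Lemma inVV f : inV H f -> inV H (f^-1)%g.
Proof.
move=> [_ loc]; split=> [|x].
  by exists f; split; [apply: winvK | apply: wfunK].
have [w1 [w2 [s [Hs /inbP xw fw]]]] := loc ((f^-1)%g x).
exists w2, w1, (s^-1)%g; split; rewrite ?groupV //; last exact: (wbij_affrV fw).
by apply/inbP; rewrite -(wbij_inb _ fw) in xw; rewrite -(winvK f x).
Qed.

Lemma inVM f g : inV H f -> inV H g -> inV H (f * g)%g.
Proof.
move=> [_ locf] [_ locg]; split=> [|x].
  by exists ((f * g)^-1)%g; split; [apply: wfunK | apply: winvK].
have [w1 [w2 [s [Hs /inbP/inbE[y ->] fw]]]] := locf x.
have [v1 [v2 [t [Ht /inbP xv gv]]]] := locg (f (app w1 y)).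
(* With [size v1] further letters, the image of the ball under [f] is small enough to lie inside the
   ball [v1]. *)
pose z := mkseq y (size v1).
exists (w1 ++ z); have := affr_cat z fw.
have /prefixP[z' ->] : prefix v1 (w2 ++ map s z).
  apply: inb_size xv _ _; last by rewrite size_cat size_map size_mkseq leq_addl.
  rewrite (wbij_inb _ (affr_cat z fw)) inb_app_cat; exact: inb_mkseq.
move=> fz; exists (v2 ++ map t z'), (s * t)%g; split; rewrite ?groupM //.
  by apply/inbP; rewrite inb_app_cat inb_mkseq.
exact: wbij_affrM fz (affr_cat z' gv).
Qed.

End VGroup.

(** * Homeomorphisms given by rows and the identity elsewhere *)

Section Local.
Variable d : nat.
Hypothesis hd : 1 < d.
Implicit Types (T : seq (row d)) (r : row d) (v u w z : seq 'I_d).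

Fixpoint locf T (x : word d) : word d :=
  if T is r :: T' then
    if inb (src r) x then app (tgt r) (lact (lab r) (shift (size (src r)) x))
    else locf T' x
  else x.

Definition cnt (f : row d -> seq 'I_d) T x := count (inb^~ x) (map f T).

(** The sources are disjoint, so are the targets, and both have the same union; extending the rows
    by the identity then gives a bijection. *)
Definition locok T := forall x, cnt src T x <= 1 /\ cnt tgt T x = cnt src T x.

Definition rowV r : row d := (tgt r, src r, (lab r)^-1)%g.

Lemma locf_in T r : (forall x, cnt src T x <= 1) -> r \in T -> affr (locf T) r.
Proof.
move=> c1 rT y; elim: T rT c1 => //= r' T IH; rewrite inE.
case/predU1P=> [->|rT] c1; first by rewrite inb_app shift_app.
case: ifP => [r'r|_]; last first.
  by apply: IH => // x; apply: leq_trans (c1 x); apply: leq_addl.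
have := c1 (app (src r) y); rewrite /cnt /= r'r ltnS leqNgt -has_count => /hasPn.
by move=> /(_ _ (map_f src rT)); rewrite inb_app.
Qed.

Lemma locf_out T x : cnt src T x = 0 -> locf T x = x.
Proof.
by elim: T => //= r T IH /eqP; rewrite /cnt /= addn_eq0 eqb0 => /andP[/negPf-> /eqP/IH].
Qed.

Lemma cnt_pos f T x : 0 < cnt f T x -> exists2 r, r \in T & inb (f r) x.
Proof. by rewrite -has_count => /hasP[_ /mapP[r rT ->]]; exists r. Qed.

Lemma cntV T x : cnt src (map rowV T) x = cnt tgt T x /\ cnt tgt (map rowV T) x = cnt src T x.
Proof. by rewrite /cnt -!map_comp. Qed.

Lemma locokV T : locok T -> locok (map rowV T).
Proof. by move=> ok x; have [c1 e] := ok x; have [-> ->] := cntV T x; rewrite e. Qed.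

Lemma locfK T : locok T -> cancel (locf T) (locf (map rowV T)).
Proof.
move=> ok x; have [c1 e] := ok x; case: (posnP (cnt src T x)) => c0.
  by rewrite (locf_out c0) locf_out // (cntV T x).1 e.
have [r rT /inbE[y ->]] := cnt_pos c0.
rewrite locf_in //; last by move=> z; case: (ok z).
rewrite (locf_in _ (map_f rowV rT)) /=; last by move=> z; case: (locokV ok z).
by rewrite -lactM mulgV lact1.
Qed.

Lemma locfVK T : locok T -> cancel (locf (map rowV T)) (locf T).
Proof.
move=> ok; have := locfK (locokV ok).
suff -> : map rowV (map rowV T) = T by [].
rewrite -map_comp -[RHS]map_id; apply: eq_map => r.
by rewrite /= {2}(rowE r) /rowV /src /tgt /lab /= invgK.
Qed.

(* Junk value 1 when the balls of [T] are not permuted by it. *)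
Definition loc T : wbij d :=
  if pselect (locok T) is left ok then Wbij (locfK ok) (locfVK ok) else 1%g.

Lemma loc_locf T : locok T -> loc T = locf T :> (word d -> word d).
Proof. by rewrite /loc; case: pselect. Qed.

Lemma loc_in T r : locok T -> r \in T -> affr (loc T) r.
Proof. by move=> ok; rewrite loc_locf //; apply: locf_in => x; case: (ok x). Qed.

Lemma loc_out T x : locok T -> cnt src T x = 0 -> loc T x = x.
Proof. by move=> ok; rewrite loc_locf //; apply: locf_out. Qed.

Lemma loc_eq T (g : wbij d) : locok T -> {in T, forall r, affr g r} ->
  (forall x, cnt src T x = 0 -> g x = x) -> loc T = g.
Proof.
move=> ok gT g0; apply: wbijP => x; case: (posnP (cnt src T x)) => c0.
  by rewrite loc_out ?g0.
have [r rT /inbE[y ->]] := cnt_pos c0.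
by rewrite (loc_in ok rT) gT.
Qed.

Lemma locok_perm T T' : perm_eq T T' -> locok T -> locok T'.
Proof.
move=> TT' ok x; have := ok x; rewrite /cnt.
by have /seq.permP-> := perm_map src TT'; have /seq.permP-> := perm_map tgt TT'.
Qed.

Lemma loc_perm T T' : perm_eq T T' -> locok T -> loc T = loc T'.
Proof.
move=> TT' ok; have ok' := locok_perm TT' ok; apply: loc_eq => // [r rT|x c0].
  by apply: loc_in => //; rewrite -(perm_mem TT').
by apply: loc_out => //; move: c0; rewrite /cnt; have /seq.permP-> := perm_map src TT'.
Qed.

Lemma loc_fix T v : locok T -> {in T, forall r, inc (src r) v} -> affr (loc T) (v, v, 1%g).
Proof.
move=> ok Tv y; rewrite loc_out ?lact1 //.
apply/eqP; rewrite -leqn0 leqNgt; apply/negP => /cnt_pos[r rT rv].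
by have := inc_inb (Tv r rT) rv; rewrite inb_app.
Qed.

Lemma cnt_cat f T1 T2 x : cnt f (T1 ++ T2) x = cnt f T1 x + cnt f T2 x.
Proof. by rewrite /cnt map_cat count_cat. Qed.

Lemma loc_cat T1 T2 : locok T1 -> locok T2 -> (forall x, cnt src (T1 ++ T2) x <= 1) ->
  locok (T1 ++ T2) /\ loc (T1 ++ T2) = (loc T1 * loc T2)%g.
Proof.
move=> ok1 ok2 c12.
have ok : locok (T1 ++ T2).
  by move=> x; split=> //; rewrite !cnt_cat (ok1 x).2 (ok2 x).2.
split=> //; apply: loc_eq => // [r|x]; last first.
  by rewrite cnt_cat wmulE => /eqP; rewrite addn_eq0 => /andP[/eqP c1 /eqP c2]; rewrite !loc_out.
rewrite mem_cat => /orP[rT|rT] y; rewrite wmulE.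
  rewrite (loc_in ok1 rT) loc_out //.
  have := c12 (app (tgt r) (lact (lab r) y)); rewrite cnt_cat -(ok1 _).2.
  have : 0 < cnt tgt T1 (app (tgt r) (lact (lab r) y)).
    by rewrite -has_count; apply/hasP; exists (tgt r); rewrite ?map_f ?inb_app.
  by case: (cnt tgt T1 _) => // n _; rewrite addSn ltnS leqn0 addn_eq0 => /andP[_ /eqP].
rewrite [loc T1 _]loc_out ?(loc_in ok2 rT) //.
have := c12 (app (src r) y); rewrite cnt_cat.
have : 0 < cnt src T2 (app (src r) y).
  by rewrite -has_count; apply/hasP; exists (src r); rewrite ?map_f ?inb_app.
by case: (cnt src T2 _) => // n _; rewrite addnS ltnS leqn0 addn_eq0 => /andP[/eqP].
Qed.

Lemma loc_flatten (I : eqType) (l : seq I) (F : I -> seq (row d)) :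
  {in l, forall i, locok (F i)} -> (forall x, cnt src (flatten (map F l)) x <= 1) ->
  locok (flatten (map F l)) /\ loc (flatten (map F l)) = (\prod_(i <- l) loc (F i))%g.
Proof.
elim: l => [|i l IH] okF c1.
  rewrite big_nil; have ok : locok [::] by [].
  by split=> //; apply: loc_eq.
have [|x|ok E] := IH; first by move=> j jl; apply: okF; rewrite inE jl orbT.
  by apply: leq_trans (c1 x); rewrite cnt_cat leq_addl.
rewrite big_cons -E; apply: loc_cat => //; apply: okF; exact: mem_head.
Qed.

Lemma cnt_refine_src p T x : cnt src (refine p T) x = cnt src T x.
Proof. by rewrite /cnt count_refine // => r; apply: count_split_src. Qed.

(** As [p] carries the balls of [T] to other balls with trivial label, conjugation merely renames
    them. Both the conjugacies between generators and the commutation of disjoint ones come from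
    this. *)
Lemma loc_conj (p : wbij d) (m : seq 'I_d -> seq 'I_d) T : locok T ->
  {in T, forall r, affr p (src r, m (src r), 1%g) /\ affr p (tgt r, m (tgt r), 1%g)} ->
  (loc T ^ p)%g = loc [seq (m (src r), m (tgt r), lab r) | r <- T].
Proof.
move=> ok pT; set T' := map _ T.
have cs x : cnt src T' (p x) = cnt src T x.
  rewrite /cnt -map_comp !count_map; apply: eq_in_count => r /pT[ps _].
  exact: wbij_inb ps.
have ct x : cnt tgt T' (p x) = cnt tgt T x.
  rewrite /cnt -map_comp !count_map; apply: eq_in_count => r /pT[_ pt].
  exact: wbij_inb pt.
have pV x : p ((p^-1)%g x) = x by apply: winvK.
have ok' : locok T' by move=> x; rewrite -(pV x) cs ct.
apply/esym/loc_eq => // [_ /mapP[r rT ->]|x c0].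
  have [ps pt] := pT r rT.
  have := wbij_affrM (wbij_affrV ps) (wbij_affrM (loc_in ok rT) pt).
  by rewrite invg1 mul1g mulg1.
by rewrite /conjg !wmulE loc_out ?pV // -cs pV.
Qed.

End Local.

Arguments loc {d} T.
Arguments cnt {d} f T x.

(** * Swaps of balls, local copies of H, and their splitting *)

Section SwapsAndRotations.
Variable d : nat.
Hypothesis hd : 1 < d.
Implicit Types (T : seq (row d)) (r : row d) (v u w z : seq 'I_d) (h : {perm 'I_d}).
Local Open Scope group_scope.

Definition swap_rows v w : seq (row d) := [:: (v, w, 1); (w, v, 1)].
Definition swap v w : wbij d := loc (swap_rows v w).
Definition lam w h : wbij d := loc [:: (w, w, h)].
(** Only the first letter after [w] is permuted, nothing below it: this is the defect left when
    [lam w h] is split. *)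
Definition wperm_rows w h : seq (row d) :=
  [seq (rcons w a, rcons w (h a), 1) | a <- enum 'I_d].
Definition wperm w h : wbij d := loc (wperm_rows w h).

Lemma swap_ok v w : inc v w -> locok (swap_rows v w).
Proof.
move=> vw x; rewrite /cnt /= !addn0 [inb w x + _]addnC; split=> //.
case vx: (inb v x); rewrite ?(inc_inb vw vx) //.
by case: (inb w x).
Qed.

Lemma lam_ok w h : locok [:: (w, w, h)].
Proof. by move=> x; rewrite /cnt /= addn0 leq_b1. Qed.

Lemma cnt_wperm w h x :
  cnt src (wperm_rows w h) x = inb w x /\ cnt tgt (wperm_rows w h) x = inb w x.
Proof.
have s_rows : map src (wperm_rows w h) = [seq rcons w a | a <- enum 'I_d].
  by rewrite /wperm_rows -map_comp.
have t_rows : map tgt (wperm_rows w h) = map tgt (split (w, w, h)).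
  by rewrite /wperm_rows /split -!map_comp.
by rewrite /cnt s_rows t_rows count_children count_split_tgt.
Qed.

Lemma wperm_ok w h : locok (wperm_rows w h).
Proof. by move=> x; have [-> ->] := cnt_wperm w h x; rewrite leq_b1. Qed.

Lemma swap_l v w : inc v w -> affr (swap v w) (v, w, 1).
Proof. by move=> /swap_ok ok; apply: loc_in => //; rewrite inE eqxx. Qed.

Lemma swap_r v w : inc v w -> affr (swap v w) (w, v, 1).
Proof. by move=> /swap_ok ok; apply: loc_in => //; rewrite !inE eqxx orbT. Qed.

Lemma swap_fix v w z : inc v w -> inc v z -> inc w z -> affr (swap v w) (z, z, 1).
Proof.
move=> vw vz wz; apply: loc_fix (swap_ok vw) _ => r.
by rewrite !inE => /orP[/eqP->|/eqP->].
Qed.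

Lemma swap_out v w x : inc v w -> inb v x = false -> inb w x = false -> swap v w x = x.
Proof.
by move=> vw vx wx; apply: loc_out (swap_ok vw) _; rewrite /cnt /= [inb v x]vx [inb w x]wx.
Qed.

Lemma lam_in w h : affr (lam w h) (w, w, h).
Proof. by apply: loc_in (lam_ok w h) _; rewrite inE. Qed.

Lemma lam_fix w h z : inc w z -> affr (lam w h) (z, z, 1).
Proof. by move=> wz; apply: loc_fix (lam_ok w h) _ => r; rewrite inE => /eqP->. Qed.

Lemma lam_out w h x : inb w x = false -> lam w h x = x.
Proof. by move=> wx; apply: loc_out (lam_ok w h) _; rewrite /cnt /= [inb w x]wx. Qed.

Lemma wperm_in w h a : affr (wperm w h) (rcons w a, rcons w (h a), 1).
Proof.
by apply: loc_in (wperm_ok w h) _; apply/mapP; exists a; rewrite ?mem_enum.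
Qed.

Lemma wperm_out w h x : inb w x = false -> wperm w h x = x.
Proof. by move=> wx; apply: loc_out (wperm_ok w h) _; rewrite (cnt_wperm w h x).1 wx. Qed.

Lemma swapC v w : inc v w -> swap v w = swap w v.
Proof. move=> vw; apply: loc_perm (swap_ok vw); rewrite perm_sym.
exact: (permEl (perm_rev (swap_rows v w))). Qed.

Lemma swapK v w : inc v w -> swap v w * swap v w = 1.
Proof.
move=> vw; apply: wbijP => x; rewrite wmulE.
case vx: (inb v x).
  have [y ->] := inbE vx; rewrite (swap_l vw) lact1.
  by rewrite (swap_r vw) lact1.
case wx: (inb w x); last by rewrite !swap_out.
have [y ->] := inbE wx; rewrite (swap_r vw) lact1.
by rewrite (swap_l vw) lact1.
Qed.

Lemma swapV v w : inc v w -> (swap v w)^-1 = swap v w.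
Proof. by move=> /swapK/(congr1 (mulg (swap v w)^-1)); rewrite mulKg mulg1. Qed.

Lemma swap_conj v w u : inc v w -> inc v u -> inc w u -> swap v w ^ swap w u = swap v u.
Proof.
move=> vw vu wu; pose m z := if z == w then u else z.
have mw : m w = u by rewrite /m eqxx.
have mv : m v = v by rewrite /m (negPf (inc_neq vw)).
have aw : affr (swap w u) (w, m w, 1) by rewrite mw; apply: swap_l.
have av : affr (swap w u) (v, m v, 1).
  by rewrite mv; apply: swap_fix; rewrite // incC.
rewrite (loc_conj (m := m) (swap_ok vw)) /= ?mw ?mv // => r.
by rewrite !inE => /orP[/eqP->|/eqP->].
Qed.

Lemma lam_conj w u h : inc w u -> lam w h ^ swap w u = lam u h.
Proof.
move=> wu; rewrite (loc_conj (m := fun=> u) (lam_ok w h)) //= => r.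
by rewrite inE => /eqP->; split; apply: swap_l.
Qed.

Lemma lamM w h k : lam w (h * k) = lam w h * lam w k.
Proof.
apply: loc_eq (lam_ok _ _) _ _ => [r|x].
  by rewrite inE => /eqP->; apply: wbij_affrM; apply: lam_in.
by rewrite /cnt /= addn0 => /eqP; rewrite eqb0 => /negPf wx; rewrite !lam_out.
Qed.

Lemma lam1 w : lam w 1 = 1.
Proof. by apply: (mulgI (lam w 1)); rewrite -lamM !mulg1. Qed.

Lemma lamV w h : (lam w h)^-1 = lam w h^-1.
Proof. by apply/esym/(mulIg (lam w h)); rewrite -lamM !mulVg lam1. Qed.

Lemma wpermM w h k : wperm w (h * k) = wperm w h * wperm w k.
Proof.
apply: loc_eq (wperm_ok _ _) _ _ => [_ /mapP[a _ ->]|x].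
  rewrite permM -[1]mulg1; apply: wbij_affrM; apply: wperm_in.
by rewrite (cnt_wperm _ _ x).1 => /eqP; rewrite eqb0 wmulE => /negPf wx; rewrite !wperm_out.
Qed.

Lemma wperm1 w : wperm w 1 = 1.
Proof. by apply: (mulgI (wperm w 1)); rewrite -wpermM !mulg1. Qed.

Lemma wperm_tperm w a b : a != b -> wperm w (tperm a b) = swap (rcons w a) (rcons w b).
Proof.
move=> ab; have iab : inc (rcons w a) (rcons w b) by rewrite inc_children.
apply: loc_eq (wperm_ok _ _) _ _ => [_ /mapP[c _ ->]|x].
  case: tpermP => [->|->|/eqP ca /eqP cb]; [exact: swap_l|exact: swap_r|].
  by apply: swap_fix; rewrite // inc_children eq_sym.
rewrite (cnt_wperm _ _ x).1 => /eqP; rewrite eqb0 => /negPf wx.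
by apply: swap_out; rewrite // inb_rcons wx.
Qed.

Lemma swap_split v w : inc v w ->
  swap v w = \prod_(a <- enum 'I_d) swap (rcons v a) (rcons w a).
Proof.
move=> vw; pose F a := swap_rows (rcons v a) (rcons w a).
have cF x l : cnt src (flatten (map F l)) x =
    (count (inb^~ x) (map (rcons v) l) + count (inb^~ x) (map (rcons w) l))%N.
  elim: l => //= a l IH; rewrite [cnt src _ x](cnt_cat src (F a)) IH addnACA.
  by rewrite /F /cnt /= addn0.
have cFd x : cnt src (flatten (map F (enum 'I_d))) x = cnt src (swap_rows v w) x.
  by rewrite cF !count_children /cnt /= addn0.
have [|x|okF EF] := @loc_flatten d _ (enum 'I_d) F.
- by move=> a _; apply/swap_ok/inc_rconsl/inc_rconsr.
- by rewrite cFd; case: (swap_ok vw x).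
rewrite -EF; have aF r : r \in swap_rows v w -> affr (loc (flatten (map F (enum 'I_d)))) r.
  move=> rT; apply: affr_merge => a; apply: loc_in okF _; apply/flatten_mapP.
  exists a; rewrite ?mem_enum //; move: rT.
  by rewrite !inE /child => /orP[] /eqP->; rewrite /src /tgt /lab /= perm1 eqxx ?orbT.
apply: loc_eq (swap_ok vw) aF _ => x; rewrite -cFd; exact: loc_out.
Qed.

(** The action of [h] below [w] is its action inside each child followed by the permutation of the
    children. In the abelianization this becomes the relation between [lam] and swaps. *)
Lemma lam_split w h :
  lam w h = (\prod_(a <- enum 'I_d) lam (rcons w a) h) * wperm w h.
Proof.
pose F a : seq (row d) := [:: (rcons w a, rcons w a, h)].
have cF x : cnt src (flatten (map F (enum 'I_d))) x = inb w x.
  rewrite -(count_children w x); elim: (enum 'I_d) => //= a l IH.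
  by rewrite [cnt src _ x](cnt_cat src (F a)) IH /cnt /= addn0.
have [|x|okF <-] := @loc_flatten d _ (enum 'I_d) F.
- by move=> a _; apply: lam_ok.
- by rewrite cF leq_b1.
apply: loc_eq (lam_ok w h) _ _ => [r|x]; last first.
  rewrite /cnt /= addn0 => /eqP; rewrite eqb0 => /negPf wx.
  by rewrite loc_out ?cF ?wx // wperm_out.
rewrite inE => /eqP->; apply: affr_merge => a.
rewrite /child /src /tgt /lab /= -{3}[h]mulg1; apply: wbij_affrM (wperm_in w h a).
apply: loc_in okF _; apply/flatten_mapP; exists a; rewrite ?mem_enum //.
exact: mem_head.
Qed.

End SwapsAndRotations.

(** * Membership of the generators in V_d(H), and their invariants *)

Section LocalInV.
Variable d : nat.
Hypothesis hd : 1 < d.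
Variable H : {group {perm 'I_d}}.
Implicit Types (T : seq (row d)) (r : row d) (v u w z : seq 'I_d) (h : {perm 'I_d}).

Definition idrow r := (src r == tgt r) && (lab r == 1%g).

(** The rows of [T] are completed by identity rows on the complement, which is cut into balls of one
    length [N], at least that of every source. *)
Lemma loc_table T : locok T -> {in T, forall r, lab r \in H} ->
  exists2 Z, istable H (loc T) (T ++ Z) & all idrow Z.
Proof.
move=> ok HT; pose N := foldr maxn 0 [seq size (src r) | r <- T].
have leN : {in T, forall r, size (src r) <= N}.
  rewrite /N; elim: T {N ok HT} => //= r' T1 IH r; rewrite inE leq_max.
  by case/predU1P => [->|/IH ->]; rewrite ?leqnn ?orbT.
pose L := iter N (refine xpredT) [:: ([::], [::], 1%g) : row d].
have cL x : count (fun r => inb (src r) x) L = 1.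
  rewrite -[LHS]/(count (preim src (inb^~ x)) L) -count_map -[LHS]/(cnt src L x) /L.
  by elim: (N) => // n IH; rewrite iterS cnt_refine_src.
have L1 : all idrow L.
  rewrite /L; elim: (N) => [|n IH]; first by rewrite /= /idrow !eqxx.
  rewrite iterS; apply/allP => r.
  case/refineP=> [[]//|[r' [a [r'T _ ->]]]].
  have /andP[/eqP e /eqP l1] := allP IH r' r'T.
  by rewrite /idrow /child /src /tgt /lab /= -[r'.2]/(lab r') l1 perm1 -[r'.1.1]/(src r') e !eqxx.
have Lsz : {in L, forall r, size (src r) = N}.
  rewrite /L; elim: (N) => [r|n IH r]; first by rewrite inE => /eqP->.
  rewrite iterS => /refineP[[]//|[r' [a [/IH e _ ->]]]].
  by rewrite /src /= size_rcons; congr _.+1.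
(* A ball of length [N] lies inside a source or is disjoint from all of them; those of the second
   kind are kept. *)
pose p r := ~~ has (fun t => prefix (src t) (src r)) T.
have pE r x : r \in L -> inb (src r) x -> p r = (cnt src T x == 0).
  move=> rL rx; rewrite /p -[RHS]negbK -lt0n -has_count has_map; congr (~~ _).
  apply: eq_in_has => t tT /=; apply/idP/idP => [/inb_prefix-> //|tx].
  by apply: inb_size tx rx _; rewrite (Lsz r rL) leN.
exists (filter p L); last by rewrite all_filter; apply: sub_all L1 => r /= ->; rewrite implybT.
apply: istable_intro => [|x|r].
- exact: wbij_bij.
- rewrite map_cat count_cat -[X in X + _]/(cnt src T x) count_map count_filter.
  have -> : count (predI (preim src (inb^~ x)) p) L = (cnt src T x == 0).
    transitivity (count (predI (fun r => inb (src r) x) (fun=> cnt src T x == 0)) L).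
      apply: eq_in_count => r rL /=; case rx: (inb (src r) x) => //=; exact: pE.
    case: eqP => _; rewrite -[RHS]/(nat_of_bool _).
      by rewrite /= -(cL x); apply: eq_count => r; rewrite /= andbT.
    by rewrite /= -(count_pred0 L); apply: eq_count => r; rewrite /= andbF.
  by case: (ok x) => + _; case: (cnt src T x) => [|[|]].
rewrite mem_cat => /orP[rT|]; first by split; [apply: HT | apply: loc_in].
rewrite mem_filter => /andP[pr rL]; have /andP[/eqP e /eqP l1] := allP L1 r rL.
rewrite l1 group1; split=> // y; rewrite -e l1 lact1 loc_out //; apply/eqP.
by rewrite -(pE r) // inb_app.
Qed.

Lemma loc_inV T : locok T -> {in T, forall r, lab r \in H} -> inV H (loc T).
Proof.
move=> ok HT; have [Z gZ _] := loc_table ok HT.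
exact: istable_inV (wbij_bij _) gZ.
Qed.

Lemma swap_inV v w : inc v w -> inV H (swap v w).
Proof.
move=> /swap_ok vw; apply: loc_inV => // r.
by rewrite !inE => /orP[]/eqP->; apply: group1.
Qed.

Lemma lam_inV w h : h \in H -> inV H (lam w h).
Proof. by move=> Hh; apply: loc_inV (lam_ok w h) _ => r; rewrite inE => /eqP->. Qed.

Lemma wperm_inV w h : inV H (wperm w h).
Proof. by apply: loc_inV (wperm_ok w h) _ => _ /mapP[a _ ->]; apply: group1. Qed.

Section Phi.
Variables (Q : zmodType) (eta : {perm 'I_d} -> Q) (eps : Q).
Hypothesis etaM : {in H &, forall s t, eta (s * t)%g = (eta s + eta t)%R}.
Hypothesis eps2 : (eps *+ 2 = 0)%R.
Hypothesis epsd : (eps *+ d = eps)%R.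
Hypothesis etad : {in H, forall s, (eta s *+ d.-1 = eps *+ odd_perm s)%R}.
Local Open Scope ring_scope.

Notation phi := (phi H eta eps).
Notation value := (value eta eps).
Notation pairsum := (pairsum eps).

Lemma eta1 : eta 1%g = 0.
Proof. by apply: (addrI (eta 1%g)); rewrite -etaM ?group1 // mulg1 addr0. Qed.

Lemma inversion_id r r' : idrow r -> idrow r' -> inversion r r' = false.
Proof.
move=> /andP[/eqP e _] /andP[/eqP e' _]; rewrite /inversion -e -e'.
by case lt: (lexlt (src r) _) => //; apply/negP => /(lexlt_trans lt); rewrite lexlt_irr.
Qed.

Lemma value_idrows Z : all idrow Z -> value Z = 0.
Proof.
move=> /allP Z1; rewrite /value /pairsum !big_seq !big1 ?addr0 // => r /Z1 r1.
  by rewrite big1_seq // => r' /= /Z1 r'1; rewrite inversion_id.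
by have /andP[_ /eqP->] := r1; rewrite eta1.
Qed.

Lemma phi_lam w h : h \in H -> phi (lam w h) = eta h.
Proof.
move=> Hh; have [|Z gZ Z1] := @loc_table _ (lam_ok w h).
  by move=> r; rewrite inE => /eqP->.
(* Inversions ignore labels, so [(w, w, h)] behaves here like an identity row. *)
have zr r : r \in Z -> inversion r (w, w, h) = false /\ inversion (w, w, h) r = false.
  move=> /(allP Z1) r1.
  have := @inversion_id r (w, w, 1%g) r1; have := @inversion_id (w, w, 1%g) r.
  by rewrite /idrow /= !eqxx => /(_ isT r1) + /(_ isT).
rewrite (phiE hd eps2 epsd etad gZ) value_cat (value_idrows Z1) addr0.
rewrite {1}/value /pairsum !big_seq1 {1}/inversion !lexlt_irr mulr0n addr0.
rewrite big1_seq ?big1_seq ?addr0 // => r /= /zr[rw wr].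
  by rewrite big_seq1 rw.
by rewrite wr.
Qed.

(** A fixed ball between [v] and [w] is inverted with both swapped rows, any other with neither, so
    these terms cancel by [eps2]. The two swapped rows form one inversion. *)
Lemma phi_swap v w : inc v w -> phi (swap v w) = eps.
Proof.
move=> vw; have [|Z gZ Z1] := loc_table (swap_ok vw).
  by move=> r; rewrite !inE => /orP[]/eqP->; apply: group1.
rewrite (phiE hd eps2 epsd etad gZ) value_cat (value_idrows Z1) addr0.
have -> : pairsum (swap_rows v w) Z + pairsum Z (swap_rows v w) = 0.
  rewrite /pairsum /swap_rows !big_cons !big_nil addr0 -!big_split big_seq big1 //= => r rZ.
  have /andP[/eqP e _] := allP Z1 r rZ.
  rewrite !big_cons !big_nil addr0 /inversion /src /tgt /= -[r.1.1]/(src r) -[r.1.2]/(tgt r) -e.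
  rewrite -!eps_addb // ![lexlt (src r) _ && _]andbC.
  by case: (_ && _); case: (_ && _).
rewrite addr0 /value /pairsum /swap_rows !big_cons !big_nil !addr0 /inversion /= !lexlt_irr /=.
rewrite /src /tgt /lab /= eta1 !add0r !addr0 !andbb -eps_addb //.
by rewrite (lexlt_total (inc_neq vw)) addbN addbb.
Qed.

End Phi.
End LocalInV.

(** * Generation by small swaps and small copies of H *)

Section Generation.
Variable d : nat.
Hypothesis hd : 1 < d.
Variable H : {group {perm 'I_d}}.
Implicit Types (T : seq (row d)) (r : row d) (v u w z : seq 'I_d) (h : {perm 'I_d}).
Implicit Types (x y p g : wbij d).
Local Open Scope group_scope.

(** Products without inverses suffice, because the generating sets in use are closed under
    inversion. *)
Inductive gen (S : wbij d -> Prop) : wbij d -> Prop :=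
| gen1 : gen S 1
| genM x y : S x -> gen S y -> gen S (x * y).

Lemma gen_in S x : S x -> gen S x.
Proof. by move=> Sx; rewrite -[x]mulg1; apply: genM Sx (gen1 _). Qed.

Lemma genMM S x y : gen S x -> gen S y -> gen S (x * y).
Proof.
by move=> Sx Sy; elim: Sx => [|a b Sa _ IH]; rewrite ?mul1g // -mulgA; apply: genM.
Qed.

Lemma gen_sub S S' x : (forall y, S y -> gen S' y) -> gen S x -> gen S' x.
Proof.
move=> SS'; elim=> [|a b Sa _ IH]; first exact: gen1.
by apply: genMM IH; apply: SS'.
Qed.

Lemma genV S x : (forall y, S y -> S y^-1) -> gen S x -> gen S x^-1.
Proof.
move=> SV; elim=> [|a b Sa _ IH]; first by rewrite invg1; apply: gen1.
by rewrite invgM; apply: genMM IH _; apply/gen_in/SV.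
Qed.

Lemma gen_prod S (I : Type) (l : seq I) (F : I -> wbij d) :
  (forall i, gen S (F i)) -> gen S (\prod_(i <- l) F i).
Proof.
move=> SF; elim: l => [|i l IH]; first by rewrite big_nil; apply: gen1.
by rewrite big_cons; apply: genMM.
Qed.

(** The lower bound on the lengths keeps supports small, so that a disjoint ball remains
    available. *)
Definition deep k x :=
  (exists v w, [/\ inc v w, k <= size v, k <= size w & x = swap v w]) \/
  (exists w h, [/\ k <= size w, h \in H & x = lam w h]).

Lemma deep_swap k v w : inc v w -> k <= size v -> k <= size w -> deep k (swap v w).
Proof. by move=> *; left; exists v, w. Qed.

Lemma deep_lam k w h : k <= size w -> h \in H -> deep k (lam w h).
Proof. by move=> *; right; exists w, h. Qed.

Lemma deepV k x : deep k x -> deep k x^-1.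
Proof.
case=> [[v [w [vw kv kw ->]]]|[w [h [kw Hh ->]]]].
  by rewrite swapV //; apply: deep_swap.
by rewrite lamV; apply: deep_lam; rewrite ?groupV.
Qed.

Lemma deep_inV k x : deep k x -> inV H x.
Proof.
by case=> [[v [w [vw _ _ ->]]]|[w [h [_ Hh ->]]]]; [apply: swap_inV | apply: lam_inV].
Qed.

Lemma gen_wperm k w h : k <= (size w).+1 -> gen (deep k) (wperm w h).
Proof.
move=> kw; have [ts -> /=] := prod_tpermP h.
elim: ts => [|[a b] ts IH] /=; first by rewrite big_nil wperm1 => _; apply: gen1.
case/andP; rewrite /dpair /= => ab /IH{}IH; rewrite big_cons wpermM wperm_tperm //.
by apply: genM IH; apply: deep_swap; rewrite ?inc_children ?size_rcons.
Qed.

(** Splitting a generator raises its depth by one. The permutation of children left over by [lam] is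
    a product of transpositions, hence of swaps of sufficient depth. *)
Lemma gen_deeper k x : gen (deep 0) x -> gen (deep k) x.
Proof.
elim: k => // k IH /IH; apply: gen_sub => _ [[v [w [vw kv kw ->]]]|[w [h [kw Hh ->]]]].
  rewrite swap_split //; apply: gen_prod => a; apply: gen_in.
  by apply: deep_swap; rewrite ?size_rcons //; apply/inc_rconsl/inc_rconsr.
rewrite lam_split; apply: genMM; last exact: gen_wperm.
by apply: gen_prod => a; apply: gen_in; apply: deep_lam; rewrite ?size_rcons.
Qed.

Lemma seq_max (I : eqType) (f : I -> nat) (s : seq I) i0 : i0 \in s ->
  exists2 i, i \in s & {in s, forall j, f j <= f i}.
Proof.
elim: s i0 => // i s IH _ _; case: s => [|j s] in IH *.
  by exists i; rewrite ?mem_head // => j; rewrite inE => /eqP->.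
have [k ks kmax] := IH j (mem_head _ _).
case: (leqP (f i) (f k)) => [ik|/ltnW ki].
  by exists k; rewrite ?(in_cons i) ?ks ?orbT // => l; rewrite inE => /predU1P[->|/kmax].
exists i; rewrite ?mem_head // => l; rewrite inE => /predU1P[->|/kmax le] //.
exact: leq_trans le ki.
Qed.

Lemma part_mem (P : seq (seq 'I_d)) (a : word d) : part P -> exists2 w, w \in P & inb w a.
Proof. by move=> pP; apply/hasP; rewrite has_count pP. Qed.

(** Take a longest word [rcons v a0] of the partition. A ball of the partition meeting a sibling but
    shorter than it would be given by a prefix of [v], hence would contain the longest one; so every
    sibling belongs to the partition. *)
Lemma part_caret (P : seq (seq 'I_d)) w0 : part P -> w0 \in P -> w0 != [::] ->
  exists v, forall a, rcons v a \in P.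
Proof.
move=> pP w0P w0n; have c1 (x0 : word d) : count (inb^~ x0) P <= 1 by rewrite pP.
have [w wP wmax] := seq_max size w0P.
case/lastP: w wP wmax => [|v a0] wP wmax.
  by have := wmax w0 w0P; rewrite leqn0 size_eq0 (negPf w0n).
exists v => b; have [y0] := word_inhabited hd.
have [w' w'P w'x] := part_mem (app (rcons v b) y0) pP.
have := wmax w' w'P; rewrite size_rcons leq_eqVlt ltnS => /predU1P[sz|le].
  by rewrite -(inb_size_eq w'x (inb_app _ _)) ?size_rcons.
have w'v : prefix w' v.
  by apply: inb_size w'x _ le; rewrite app_rcons inb_app.
have /(part_inc hd c1 w'P wP)/andP[/negP[]] : w' != rcons v a0.
  by apply: contraTneq le => ->; rewrite size_rcons ltnn.
exact: prefix_trans w'v (prefix_rcons _ _).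
Qed.

(** One letter at a time: a swap brings the target of the row at [rcons v b] to [rcons u b], then
    [lam] cancels its label. The swap permutes the target words, so the children of [u] remain
    targets, and rows already placed are not touched. *)
Lemma align g T v u (l : seq 'I_d) :
  istable H g T -> (forall a, rcons v a \in map src T) ->
  (forall a, rcons u a \in map tgt T) -> uniq l ->
  exists p T', [/\ gen (deep 0) p, istable H (g * p) T', size T' = size T,
    map src T' = map src T /\ (forall a, rcons u a \in map tgt T') &
    {in l, forall b, (rcons v b, rcons u b, 1) \in T'}].
Proof.
move=> gT vT uT; elim: l => [_|b l IH /andP[bl /IH]].
  by exists 1, T; rewrite mulg1; split=> //; apply: gen1.
case=> p [T' [Gp gT' szT' [srcT' uT'] lT']].
have dT' := istable_disjoint gT'; have [psT' ptT' affT'] := gT'.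
have tgt_inc z z' : z \in map tgt T' -> z' \in map tgt T' -> z != z' -> inc z z'.
  by apply: part_inc => // x0; rewrite ptT'.
have /mapP[r rT' r_src] : rcons v b \in map src T' by rewrite srcT'.
have [Hr _] := affT' r rT'.
set x := tgt r; set y := rcons u b.
have xT : x \in map tgt T' by apply: map_f.
have yT : y \in map tgt T' by apply: uT'.
pose m z := if z == x then y else if z == y then x else z.
have mT z : z \in map tgt T' -> m z \in map tgt T'.
  by rewrite /m; case: eqP => // _; case: eqP.
have mK : involutive m.
  move=> z; rewrite /m; case: (eqVneq z x) => [->|zx].
    by rewrite eqxx; case: eqP.
  case: (eqVneq z y) => [->|zy]; first by rewrite eqxx.
  by rewrite (negPf zx) (negPf zy).
(* The row may already end at [y], and a word cannot be swapped with itself. *)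
pose q1 := if x == y then 1 else swap x y.
have q1P z : z \in map tgt T' -> affr q1 (z, m z, 1).
  move=> zT; rewrite /q1 /m; case: (eqVneq x y) => [->|xy].
    by case: eqP => [->|_] a; rewrite lact1.
  have ixy := tgt_inc _ _ xT yT xy.
  case: (eqVneq z x) => [->|zx]; first exact: swap_l.
  case: (eqVneq z y) => [->|zy]; first exact: swap_r.
  by apply: swap_fix; rewrite // tgt_inc // eq_sym.
pose q2 := lam y (lab r)^-1.
pose c z := if z == y then (lab r)^-1 else 1.
have q2P z : z \in map tgt T' -> affr q2 (z, z, c z).
  move=> zT; rewrite /q2 /c; case: (eqVneq z y) => [->|zy]; first exact: lam_in.
  by apply: lam_fix; apply: tgt_inc; rewrite // eq_sym.
have Hc z : c z \in H by rewrite /c; case: ifP; rewrite ?groupV ?group1.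
pose F r' : row d := (src r', m (tgt r'), lab r' * c (m (tgt r'))).
exists (p * (q1 * q2)), (map F T'); split.
- apply: genMM Gp _; apply: genMM; last by apply/gen_in/deep_lam; rewrite ?groupV.
  rewrite /q1; case: (eqVneq x y) => [_|xy]; first exact: gen1.
  by apply/gen_in/deep_swap => //; apply: tgt_inc.
- apply: istable_intro; first exact: wbij_bij.
    by rewrite -map_comp.
  move=> _ /mapP[r' r'T ->]; have [Hr' gr'] := affT' r' r'T.
  split; first by apply: groupM Hr' (Hc _).
  have tT := map_f tgt r'T; rewrite (rowE r') in gr'.
  have := wbij_affrM (wbij_affrM gr' (q1P _ tT)) (q2P _ (mT _ tT)).
  by rewrite mulg1 -!mulgA.
- by rewrite size_map.
- split; first by rewrite -map_comp.
  move=> a; apply/mapP; have /mapP[r' r'T e] := mT _ (uT' a).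
  by exists (F r'); rewrite ?map_f // /F /tgt /= -[r'.1.2]/(tgt r') -e mK.
move=> b'; rewrite inE => /predU1P[->|b'l].
  apply/mapP; exists r => //; rewrite /F -/x /m eqxx /c eqxx mulgV -r_src //.
have r'T := lT' b' b'l; apply/mapP; exists (rcons v b', rcons u b', 1) => //.
have b'b : b' != b by apply: contraTneq b'l => ->.
have n1 : rcons u b' != y by rewrite /y eqseq_rcons eqxx.
have n2 : rcons u b' != x.
  apply: (disjoint_rows_tgt hd dT' r'T rT').
  apply: contra_neq b'b => e; have := congr1 src e.
  by rewrite -r_src => /rcons_inj[].
by rewrite /F /src /tgt /lab /= /m (negPf n1) (negPf n2) /c (negPf n1) mulg1.
Qed.

(** Induction on the number of rows: merging a caret replaces d rows by one, and d is at least 2. A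
    table with a single row is the action of some [h] on the whole space. *)
Lemma inV_gen0 g : inV H g -> gen (deep 0) g.
Proof.
move=> /(exists_table hd)[T gT].
have [n] := ubnP (size T); elim: n => // n IH in g T gT *; rewrite ltnS => szT.
have [psT ptT affT] := gT.
have caret1 (P : seq (seq 'I_d)) : part P -> size P <= 1 -> P = [:: [::]].
  case: P => [|w [|//]] pP _.
    by have [y0] := word_inhabited hd; have := pP y0.
  case: (eqVneq w [::]) => [->//|wn].
  have [v vP] := part_caret pP (mem_head _ _) wn.
  have := vP (Ordinal hd); have := vP (Ordinal (ltnW hd)); rewrite !inE => /eqP <- /eqP.
  by move=> /rcons_inj[].
have caret2 (P : seq (seq 'I_d)) : part P -> 1 < size P -> exists v, forall a, rcons v a \in P.
  move=> pP; have u1 : uniq P by apply: (part_uniq hd) => x0; rewrite pP.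
  case: P => [|w [|w' P]] // in pP u1 * => _.
  case: (eqVneq w [::]) => [w0|]; last by apply: (part_caret pP); rewrite mem_head.
  apply: (part_caret pP (w0 := w')); rewrite ?inE ?eqxx ?orbT //.
  by move: u1; rewrite w0 /= inE negb_or eq_sym => /andP[/andP[]].
case: (leqP (size T) 1) => [le1|gt1].
  have [es et] : map src T = [:: [::]] /\ map tgt T = [:: [::]].
    by split; apply: caret1; rewrite ?size_map.
  case: T => [|r [|]] // in es et affT {gT psT ptT szT le1} *.
  have [Hr gr] := affT r (mem_head _ _).
  have -> : g = lam [::] (lab r); last by apply/gen_in/deep_lam.
  move: es et => [es] [et]; apply/esym/loc_eq => [|r'|x0].
  - exact: lam_ok.
  - by rewrite inE => /eqP->; rewrite -[in X in (X, _, _)]es -[in X in (_, X, _)]et -rowE.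
  by [].
have [v vT] := caret2 _ psT (etrans (congr1 _ (size_map _ _)) gt1).
have [u uT] := caret2 _ ptT (etrans (congr1 _ (size_map _ _)) gt1).
have [p [T' [Gp gT' szT' _ alT']]] := align gT vT uT (enum_uniq 'I_d).
have Gpv : gen (deep 0) p^-1 by apply: genV Gp => z; apply: deepV.
rewrite -[g](mulgK p); apply: genMM Gpv.
(* The aligned rows are the children of one row with trivial label, which will replace them. *)
pose S := split (v, u, 1 : {perm 'I_d}).
have inS r : r \in S -> r \in T'.
  by case/mapP=> a _ ->; rewrite /child /= /tgt /= perm1; apply: alT'; rewrite mem_enum.
pose T0 := [seq r <- T' | r \notin S].
have uT' : uniq T'.
  by have [ps _ _] := gT'; apply: (@map_uniq _ _ src); apply: (part_uniq hd) => x0; rewrite ps.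
have uS : uniq S.
  apply: (@map_uniq _ _ src); rewrite src_split map_inj_uniq ?enum_uniq //.
  by move=> a b /rcons_inj[].
have pT' : perm_eq T' (S ++ T0).
  apply: uniq_perm => // [|r].
    rewrite cat_uniq uS filter_uniq // andbT; apply/hasPn => r.
    by rewrite mem_filter => /andP[].
  rewrite mem_cat mem_filter; case rS: (r \in S) => //=.
  exact: inS.
have [ps _ aff'] := istable_perm pT' gT'.
apply: (IH _ ((v, u, 1) :: T0)).
  apply: istable_intro => [|x0|r]; first exact: wbij_bij.
    by have := ps x0; rewrite map_cat count_cat count_split_src.
  rewrite inE => /predU1P[->|rT0]; last by apply: aff'; rewrite mem_cat rT0 orbT.
  split; first exact: group1.
  by apply: affr_merge => a; apply: (proj2 (aff' _ _)); rewrite mem_cat map_f ?mem_enum.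
apply: leq_trans szT; rewrite -szT' (perm_size pT') size_cat /= size_map size_enum_ord.
by rewrite -[(size T0).+1]add1n ltn_add2r.
Qed.

Lemma inV_gen k g : inV H g -> gen (deep k) g.
Proof. by move=> /inV_gen0/gen_deeper. Qed.

End Generation.

(** * Products of commutators *)

Section Commutators.
Variable d : nat.
Local Open Scope group_scope.
Implicit Types (G : wbij d -> Prop) (f a b x y : wbij d).

(* The shape of the generators is the one of [commsub], read through [wbijM]. *)
Inductive comm G : wbij d -> Prop :=
| comm1 : comm G 1
| commM f a b : comm G f -> G a -> G b -> comm G (b * a * b^-1 * a^-1 * f).

Lemma commMM G x y : comm G x -> comm G y -> comm G (x * y).
Proof.
move=> Gx Gy; elim: Gx => [|f a b _ IH Ga Gb]; first by rewrite mul1g.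
by rewrite -[_ * f * y]mulgA; apply: commM.
Qed.

Lemma comm_gen G a b : G a -> G b -> comm G (b * a * b^-1 * a^-1).
Proof. by move=> Ga Gb; rewrite -[_ * a^-1]mulg1; apply: commM (comm1 G) Ga Gb. Qed.

Lemma commV G x : comm G x -> comm G x^-1.
Proof.
elim=> [|f a b _ IH Ga Gb]; first by rewrite invg1; apply: comm1.
rewrite !invgM !invgK; apply: commMM IH _; rewrite !mulgA.
exact: comm_gen.
Qed.

Lemma comm_commg G a b : (forall x, G x -> G x^-1) -> G a -> G b -> comm G [~ a, b].
Proof.
move=> GV Ga Gb; have := comm_gen (GV _ Gb) (GV _ Ga).
by rewrite !invgK /commg /conjg !mulgA.
Qed.

Lemma comm_sub G (K : wbij d -> Prop) x : K 1 ->
  (forall x y, K x -> K y -> K (x * y)) ->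
  (forall a b, G a -> G b -> K (b * a * b^-1 * a^-1)) -> comm G x -> K x.
Proof. by move=> K1 KM KG; elim=> // f a b _ Kf Ga Gb; apply: KM => //; apply: KG. Qed.

Lemma commJ G x y : (forall z, G z -> G (z ^ y)) -> comm G x -> comm G (x ^ y).
Proof.
move=> GJ; elim=> [|f a b _ IH Ga Gb]; first by rewrite conj1g; apply: comm1.
by rewrite !conjMg !conjVg; apply: commM => //; apply: GJ.
Qed.

Lemma commsubP (G : (word d -> word d) -> Prop) (g : word d -> word d) :
  commsub G g <-> exists2 f : wbij d, g = f & comm G f.
Proof.
split=> [|[f ->]].
  elim=> [f f1|f g' a b ai bi _ [f' -> Gf'] Ga Gb aK aiK bK biK g'E].
    by exists 1; [apply: funext => x; rewrite f1 | apply: comm1].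
  exists (Wbij bK biK * Wbij aK aiK * (Wbij bK biK)^-1 * (Wbij aK aiK)^-1 * f').
    exact: funext.
  exact: commM.
elim=> [|f' a b _ IH Ga Gb]; first exact: commsub1.
by apply: (commsubM IH Ga Gb (@wfunK _ a) (@winvK _ a) (@wfunK _ b) (@winvK _ b)).
Qed.

End Commutators.

(** * A ball disjoint from four given small balls *)

Section FreeBall.
Variable d : nat.
Hypothesis hd : 1 < d.

(** Pigeonhole: each of the four balls lies in a single ball of depth 3, and there are at least 2^3
    of those. Depth 2 would give only four when d = 2. The bound 4 accounts for two generators
    supported on two balls each, or for two swaps to be compared. *)
Lemma free_ball (l : seq (seq 'I_d)) : size l <= 4 -> all (fun v => 3 <= size v) l ->
  exists2 z, size z = 3 & all (inc z) l.
Proof.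
move=> l4 l3; have : ~~ [forall t : 3.-tuple 'I_d, val t \in [seq take 3 v | v <- l]].
  apply/negP => /forallP lt.
  have : #|{: 3.-tuple 'I_d}| <= size l.
    rewrite -(size_map (take 3)) cardE -(size_map val); apply: uniq_leq_size.
      by rewrite map_inj_uniq ?enum_uniq //; apply: val_inj.
    by move=> _ /mapP[t _ ->].
  rewrite card_tuple card_ord leqNgt (leq_ltn_trans l4) //.
  by apply: leq_trans (_ : 2 ^ 3 <= _); rewrite // leq_exp2r.
rewrite negb_forall => /existsP[t tl]; exists (val t); first exact: size_tuple.
apply/allP => v vl; have v3 := allP l3 v vl.
have tv : take 3 v != val t.
  by apply: contraNneq tl => <-; rewrite map_f.
rewrite -[v](cat_take_drop 3); apply/inc_catr/inc_eqsize; last by rewrite eq_sym.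
by rewrite size_tuple size_take_min (minn_idPl v3).
Qed.

End FreeBall.

(** * The abelianization of V_d(H) *)

Section Abelianization.
Variable d : nat.
Hypothesis hd : 1 < d.
Variable H : {group {perm 'I_d}}.
Implicit Types (v u w z : seq 'I_d) (h : {perm 'I_d}) (x y g : wbij d).
Local Open Scope group_scope.

Let a1 : 'I_d := Ordinal (ltnW hd).
Let a2 : 'I_d := Ordinal hd.
Notation V := (fun g : wbij d => inV H g).

Definition swap0 : wbij d := swap (nseq 3 a1) (nseq 3 a2).

Lemma inc_swap0 : inc (nseq 3 a1) (nseq 3 a2).
Proof. exact: inc_heads. Qed.

Section Quotient.
Variables (Q : zmodType) (q : wbij d -> Q).
Hypothesis qM : forall x y, V x -> V y -> q (x * y) = (q x + q y)%R.
Hypothesis q0 : forall x, V x -> q x = 0%R <-> comm V x.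
Local Open Scope ring_scope.

Notation sigma := (q swap0).
Notation lambda h := (q (lam [:: a1] h)).

Lemma q_1 : q 1%g = 0.
Proof. by apply/q0; [apply: inV1 | apply: comm1]. Qed.

Lemma qV x : V x -> q x^-1%g = - q x.
Proof.
move=> Vx; have := qM (inVV Vx) Vx; rewrite mulVg q_1 => /esym/eqP.
by rewrite addr_eq0 => /eqP.
Qed.

Lemma qJ x y : V x -> V y -> q (x ^ y)%g = q x.
Proof.
move=> Vx Vy; have VyV := inVV Vy.
by rewrite /conjg qM ?qM ?qV //; [rewrite addrCA addNr addr0 | apply: inVM].
Qed.

Lemma inV_prod (I : Type) (l : seq I) (F : I -> wbij d) :
  (forall i, V (F i)) -> V (\prod_(i <- l) F i)%g.
Proof.
move=> VF; elim: l => [|i l IH]; first by rewrite big_nil; apply: inV1.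
by rewrite big_cons; apply: inVM.
Qed.

Lemma q_prod (I : Type) (l : seq I) (F : I -> wbij d) : (forall i, V (F i)) ->
  q (\prod_(i <- l) F i)%g = \sum_(i <- l) q (F i).
Proof.
move=> VF; elim: l => [|i l IH]; first by rewrite !big_nil q_1.
by rewrite !big_cons qM ?IH //; apply: inV_prod.
Qed.

Lemma q_swap_move v w u : inc v w -> inc v u -> inc w u -> q (swap v w) = q (swap v u).
Proof.
move=> vw vu wu; rewrite -(swap_conj vw vu wu) qJ //; apply: swap_inV => //.
Qed.

(** Moving one end of a swap requires a third disjoint ball. A ball [z] disjoint from all four words
    lets both swaps be moved to the same pair of children of [z]. *)
Lemma q_swap v w : inc v w -> (3 <= size v)%N -> (3 <= size w)%N -> q (swap v w) = sigma.
Proof.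
move=> vw v3 w3.
have [|z z3] := @free_ball d hd [:: v; w; nseq 3 a1; nseq 3 a2] isT.
  by rewrite /= v3 w3.
rewrite /= andbT => /and4P[zv zw z1 z2].
have to_z v' w' : inc v' w' -> inc z v' -> inc z w' ->
    q (swap v' w') = q (swap (rcons z a1) (rcons z a2)).
  move=> i' zv' zw'; have z12 : inc (rcons z a1) (rcons z a2) by rewrite inc_children.
  have zv1 : inc v' (rcons z a1) by rewrite incC; apply: inc_rconsl.
  have zw1 : inc w' (rcons z a1) by rewrite incC; apply: inc_rconsl.
  have zv2 : inc v' (rcons z a2) by rewrite incC; apply: inc_rconsl.
  rewrite (q_swap_move i' zv1 zw1) swapC // (q_swap_move _ z12) //.
  by rewrite incC.
by rewrite (to_z _ _ vw) // (to_z _ _ inc_swap0).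
Qed.

Lemma sigma2 : sigma *+ 2 = 0.
Proof.
have V0 : V swap0 by apply/swap_inV/inc_swap0.
by rewrite mulr2n -qM // swapK ?q_1 //; apply: inc_swap0.
Qed.

Lemma sigma_d : sigma *+ d = sigma.
Proof.
rewrite [RHS](congr1 q (swap_split inc_swap0)) q_prod => [|a]; last first.
  by apply/swap_inV => //; apply/inc_rconsl/inc_rconsr/inc_swap0.
rewrite (eq_bigr (fun=> sigma)) => [|a _]; last first.
  by apply: q_swap; rewrite ?size_rcons //; apply/inc_rconsl/inc_rconsr/inc_swap0.
by rewrite big_enum sumr_const card_ord.
Qed.

Lemma q_wperm w h : (2 <= size w)%N -> q (wperm w h) = sigma *+ odd_perm h.
Proof.
move=> w2; have [ts -> /=] := prod_tpermP h.
elim: ts => [|[a b] ts IH] /=; first by rewrite big_nil wperm1 odd_perm1 q_1.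
case/andP; rewrite /dpair /= => ab /IH{}IH.
have wab : inc (rcons w a) (rcons w b) by rewrite inc_children.
rewrite big_cons wpermM qM; [|exact: wperm_inV|exact: wperm_inV].
rewrite odd_permM odd_tperm ab (eps_addb sigma2) IH; congr (_ + _).
by rewrite wperm_tperm // q_swap // size_rcons.
Qed.

(** Disjoint balls are exchanged by a swap, which conjugates the two copies of [h]. A word beginning
    with [a1] is not disjoint from [[:: a1]], so the passage is made through [[:: a2]]; for the
    empty word there is no disjoint ball at all. *)
Lemma q_lam w h : w != [::] -> h \in H -> q (lam w h) = lambda h.
Proof.
move=> wn Hh; have q_move u u' : inc u u' -> q (lam u h) = q (lam u' h).
  by move=> uu'; rewrite -(lam_conj h uu') qJ //; [apply: lam_inV | apply: swap_inV].
case: w wn => // a w _; case: (eqVneq a a1) => [->|aa1].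
  by rewrite (q_move (a1 :: w) [:: a2]) ?inc_heads // (q_move _ [:: a1]) ?inc_heads.
by rewrite (q_move _ [:: a1]) ?inc_heads.
Qed.

Lemma lambdaM h k : h \in H -> k \in H -> lambda (h * k)%g = lambda h + lambda k.
Proof. by move=> Hh Hk; rewrite lamM qM //; apply: lam_inV. Qed.

Lemma lambda_d h : h \in H -> lambda h *+ d.-1 = sigma *+ odd_perm h.
Proof.
move=> Hh; have Vl w : V (lam w h) by apply: lam_inV.
(* A word of length 2 is taken because its children then have length 3, as the evaluation of [wperm]
   requires. *)
have : q (lam [:: a1; a1] h) = lambda h *+ d + sigma *+ odd_perm h.
  rewrite lam_split qM ?q_prod ?q_wperm //; [|exact: inV_prod|exact: wperm_inV].
  rewrite (eq_bigr (fun=> lambda h)) ?big_enum ?sumr_const ?card_ord // => a _.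
  by apply: q_lam; rewrite // -size_eq0 size_rcons.
rewrite q_lam // => E; rewrite -[LHS](addrK (lambda h)) -mulrSr prednK ?(ltnW hd) //.
by rewrite {2}E opprD addrA addrN add0r (eps_opp sigma2).
Qed.

Lemma q_gen g : V g -> exists h (e : bool), h \in H /\ q g = lambda h + sigma *+ e.
Proof.
move=> /(inV_gen hd 3); elim=> [|x y Sx Gy [h [e [Hh IH]]]].
  by exists 1%g, false; rewrite lam1 q_1 mulr0n addr0.
have Vx : V x by apply: deep_inV Sx.
have Vy : V y.
  elim: Gy => [|x' y' Sx' _ IHV]; first exact: inV1.
  by apply: inVM IHV; apply: deep_inV Sx'.
rewrite (qM Vx Vy) IH; case: Sx => [[v [w [vw v3 w3 ->]]]|[w [k [w3 Hk ->]]]].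
  exists h, (~~ e); split=> //.
  by rewrite q_swap // -addTb (eps_addb sigma2) addrCA.
exists (k * h)%g, e; rewrite groupM // lambdaM // q_lam ?addrA //.
by apply: contraTneq w3 => ->.
Qed.

Lemma sigma_even : ~~ odd d -> sigma = 0.
Proof.
move=> ev; rewrite -[LHS]sigma_d -[d]odd_double_half (negPf ev) add0n -mul2n.
by rewrite mulrnA sigma2 mul0rn.
Qed.

Lemma lambda_X h n : h \in H -> lambda (h ^+ n)%g = lambda h *+ n.
Proof.
move=> Hh; elim: n => [|n IH]; first by rewrite expg0 lam1 q_1 mulr0n.
by rewrite expgS lambdaM ?groupX // IH mulrS.
Qed.

(** Commutators vanish in an abelian target. On a power with exponent d-1, [lambda_d] gives [sigma]
    times the sign of the base, which is zero because the base is even if d is odd, and because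
    [sigma] is zero if d is even. *)
Lemma lambda_ker h : h \in Nsub H -> lambda h = 0.
Proof.
have gK : group_set [set h in H | lambda h == 0].
  apply/group_setP; split=> [|h1 h2]; first by rewrite inE group1 lam1 q_1 eqxx.
  rewrite !inE => /andP[H1 /eqP e1] /andP[H2 /eqP e2].
  by rewrite groupM // lambdaM // e1 e2 addr0 eqxx.
suff /subsetP NK : Nsub H \subset Group gK by move=> /NK; rewrite inE => /andP[_ /eqP].
have cK : [~: H, H] \subset Group gK.
  rewrite gen_subG; apply/subsetP => _ /imset2P[h1 h2 H1 H2 ->].
  rewrite inE groupR // /commg /conjg !lambdaM ?groupM ?groupV //.
  rewrite -lamV -[lam _ h2^-1]lamV !qV; [|exact: lam_inV|exact: lam_inV].
  by rewrite addrA -opprD addNr eqxx.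
have xK h1 : h1 \in H -> odd d ==> ~~ odd_perm h1 -> (h1 ^+ d.-1)%g \in Group gK.
  move=> H1 ev; rewrite inE groupX // lambda_X // lambda_d //.
  case: (boolP (odd d)) ev => [_ /= /negPf->|/sigma_even->]; first by rewrite mulr0n eqxx.
  by rewrite mul0rn eqxx.
rewrite /Nsub; case: (boolP (odd d)) => od; rewrite gen_subG subUset cK /=.
  apply/subsetP => _ /imsetP[h1 /setIP[H1 A1] ->]; apply: xK => //.
  by rewrite od /= -Alt_even.
by apply/subsetP => _ /imsetP[h1 H1 ->]; apply: xK; rewrite // (negPf od).
Qed.

End Quotient.

(** The swap survives as a separate factor only if d is odd and H consists of even permutations.
    Otherwise its class is zero or already the class of some [lam]. *)
Lemma inV_abelian :
  (forall h, h \in H -> h \in Nsub H -> comm V (lam [:: a1] h)) /\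
  (forall g, V g -> exists h (e : bool), [/\ h \in H,
     e -> odd d && (H \subset 'Alt_('I_d)) &
     comm V (g * (lam [:: a1] h * swap0 ^+ e)^-1)]).
Proof.
have Vl h : h \in H -> V (lam [:: a1] h) by apply: lam_inV.
have V0 : V swap0 by apply/swap_inV/inc_swap0.
have [||||||||Q [q [qM q0]]] := @abelian_quotient (wbij d) V (comm V).
- exact: inV1.
- by move=> x y; apply: inVM.
- exact: comm1.
- by move=> x y; apply: commMM.
- by move=> x; apply: commV.
- by move=> x; apply: inVV.
- move=> x; apply: (@comm_sub _ V V) => [|y z|a b Va Vb]; [exact: inV1|exact: inVM|].
  exact: inVM (inVM (inVM Vb Va) (inVV Vb)) (inVV Va).
- by move=> x y; apply: comm_commg => z; apply: inVV.
split=> [h Hh Nh|g Vg].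
  by apply/q0; [apply: Vl | apply: (lambda_ker qM q0)].
have [h [e [Hh E e_odd]]] : exists h (e : bool), [/\ h \in H,
    q g = (q (lam [:: a1] h) + q swap0 *+ e)%R & e -> odd d && (H \subset 'Alt_('I_d))].
  have [h [e [Hh E]]] := q_gen qM q0 Vg.
  case: (boolP (odd d)) => od; last first.
    exists h, false; split=> //.
    by rewrite E (sigma_even qM q0 od) !mul0rn.
  case: (boolP (H \subset _)) => [|/subsetPn[k Hk kA]]; first by exists h, e.
  have ok : odd_perm k by rewrite Alt_even negbK in kA.
  have HX : (k ^+ d.-1) ^+ e \in H by rewrite !groupX.
  (* For odd [k] in [H], [lambda_d] identifies the class of the swap with that of the copy of
     [k ^+ d.-1]. *)
  exists (h * (k ^+ d.-1) ^+ e), false; split; rewrite ?groupM // addr0.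
  rewrite (lambdaM qM) // !(lambda_X qM q0) ?groupX // (lambda_d qM q0) // ok.
  by rewrite mulr1n.
exists h, e; split=> //.
have Ve : V (swap0 ^+ e) by case: (e) => /=; [apply: V0 | apply: inV1].
have Vle : V (lam [:: a1] h * swap0 ^+ e) by apply: inVM Ve; apply: Vl.
have Vi := inVV Vle.
apply/q0; first exact: inVM.
rewrite (qM _ _ Vg Vi) (qV qM q0 Vle) (qM _ _ (Vl _ Hh) Ve) E; apply/eqP; rewrite subr_eq0.
by apply/eqP; congr (_ + _)%R; case: (e); rewrite // expg0 (q_1 q0).
Qed.

End Abelianization.

(** * Parity of tables for d odd and H inside the alternating group *)

Section EvenTables.
Variable d : nat.
Hypothesis hd : 1 < d.
Variable H : {group {perm 'I_d}}.
Hypothesis dodd : odd d.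
Hypothesis HA : H \subset ('Alt_('I_d))%g.
Implicit Types (f g : wbij d).

(** The invariant with values in [bool], seen as Z/2 under exclusive or. The condition on [eps] is
    that d is odd, and the condition on [eta] is that H has no odd element. *)
Definition sgn (g : word d -> word d) : bool := phi H (fun=> 0%R) true g.

Let sgn_etaM : {in H &, forall s t : {perm 'I_d}, (0 = 0 + 0 :> bool)%R}.
Proof. by []. Qed.

Let sgn_eps2 : (true *+ 2 = 0)%R.
Proof. by []. Qed.

Let sgn_epsd : (true *+ d = true)%R.
Proof. by rewrite -[d]odd_double_half dodd -mul2n GRing.mulrnDr GRing.mulrnA GRing.mul0rn. Qed.

Let sgn_etad : {in H, forall s, (0 *+ d.-1 = true *+ odd_perm s)%R}.
Proof.
move=> s Hs; rewrite GRing.mul0rn; have := subsetP HA s Hs.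
by rewrite Alt_even => /negPf->.
Qed.

Lemma sgnM f g : inV H f -> inV H g -> sgn (f * g)%g = sgn f (+) sgn g.
Proof.
move=> Vf Vg; have := @phiM _ hd H _ (fun=> 0%R) true sgn_etaM sgn_eps2 sgn_epsd sgn_etad f g Vf Vg.
by [].
Qed.

Lemma sgn_swap v w : inc v w -> sgn (swap v w).
Proof. move=> vw; exact: (@phi_swap _ hd H _ (fun=> 0%R) true sgn_etaM sgn_eps2 sgn_epsd sgn_etad _ _ vw). Qed.

Lemma sgn_lam w h : h \in H -> sgn (lam w h) = false.
Proof. by move=> Hh; apply: (@phi_lam _ hd H _ (fun=> 0%R) true sgn_etaM sgn_eps2 sgn_epsd sgn_etad w _ Hh). Qed.

Lemma sgn1 : sgn (1%g : wbij d) = false.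
Proof. by rewrite -(lam1 [::]) sgn_lam. Qed.

Lemma sgnV f : inV H f -> sgn (f^-1)%g = sgn f.
Proof.
move=> Vf; have := sgnM Vf (inVV Vf); rewrite mulgV sgn1.
by case: (sgn f) (sgn (f^-1)%g) => [] [].
Qed.

Lemma ball_partition_part m (v : 'I_m -> seq 'I_d) :
  ball_partition v <-> part [seq v i | i <- enum 'I_m].
Proof.
have c x (s : seq 'I_m) : count (inb^~ x) (map v s) = count (fun i => inb (v i) x) s.
  by rewrite count_map.
split=> [pv x|pv x].
  have [i [/inbP ix iu]] := pv x; rewrite c.
  apply: (count_enum_eq (a := i)) => j; apply/idP/eqP => [/inbP/iu ->//|->//].
have := pv x; rewrite c => c1.
have : has (fun i => inb (v i) x) (enum 'I_m) by rewrite has_count c1.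
case/hasP=> i _ ix; exists i; split=> [|j /inbP jx]; first exact/inbP.
apply: (count_le1_inj (s := enum 'I_m) (a := fun i => inb (v i) x)); rewrite ?mem_enum //.
by rewrite c1.
Qed.

Lemma sorted_lexlt m (v : 'I_m -> seq 'I_d) i j :
  (forall i j : 'I_m, i < j -> lexlt (v i) (v j)) -> lexlt (v i) (v j) = (i < j).
Proof.
move=> vs; case: ltngtP => [/vs//|ji|/val_inj->]; last exact: lexlt_irr.
by apply/negP => /(lexlt_trans (vs _ _ ji)); rewrite lexlt_irr.
Qed.

(** With words listed in lexicographic order, the inversions of the rows are those of [tau]. In
    particular the parity is the same for every table of [g]. *)
Lemma table_sgn (g : wbij d) m (v u : 'I_m -> seq 'I_d) (hs : 'I_m -> {perm 'I_d})
    (tau : {perm 'I_m}) :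
  (forall i j : 'I_m, i < j -> lexlt (v i) (v j)) ->
  (forall i j : 'I_m, i < j -> lexlt (u i) (u j)) ->
  ball_partition v -> (forall i, hs i \in H) ->
  (forall i y, g (app (v i) y) = app (u (tau i)) (lact (hs i) y)) ->
  sgn g = odd_perm tau.
Proof.
move=> vs us pv Hh gv; pose F i : row d := (v i, u (tau i), hs i).
have gT : istable H g (map F (enum 'I_m)).
  apply: istable_intro => [||_ /mapP[i _ ->]]; first exact: wbij_bij.
    by rewrite -map_comp; apply/ball_partition_part.
  by split; [apply: Hh | apply: gv].
rewrite /sgn (@phiE _ hd H _ (fun=> 0%R) true sgn_eps2 sgn_epsd sgn_etad _ _ gT) /value big1 // GRing.add0r /pairsum big_map.
transitivity (pinv true tau); last by rewrite pinv_odd //; case: (odd_perm tau).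
apply: eq_bigr => i _; rewrite big_map; apply: eq_bigr => j _.
by rewrite /inversion /F /src /tgt /= !sorted_lexlt.
Qed.

Definition lexle (v w : seq 'I_d) := (v == w) || lexlt v w.

Lemma lexle_total : total lexle.
Proof.
move=> v w; rewrite /lexle (eq_sym w); case: eqVneq => //= vw.
by rewrite (lexlt_total vw) orbN.
Qed.

Lemma lexle_trans : transitive lexle.
Proof.
move=> u v w /orP[/eqP->//|vu] /orP[/eqP<-|uw]; apply/orP; right=> //.
exact: lexlt_trans vu uw.
Qed.

Lemma sort_lexlt (P : seq (seq 'I_d)) (i j : nat) :
  uniq P -> j < size P -> i < j -> lexlt (nth [::] (sort lexle P) i) (nth [::] (sort lexle P) j).
Proof.
move=> uP jP ij; have iP := ltn_trans ij jP.
have := sorted_ltn_nth lexle_trans [::] (sort_sorted lexle_total P).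
move=> /(_ i j); rewrite !inE !size_sort => /(_ iP jP ij) /orP[|//].
by rewrite nth_uniq ?size_sort ?sort_uniq // => /eqP e; rewrite e ltnn in ij.
Qed.

(** Rows are sorted by source and the targets are sorted separately; [tau] sends the index of a row
    to the rank of its target. *)
Lemma sgn_table (g : wbij d) : inV H g -> sgn g = false -> has_even_table H g.
Proof.
move=> /(exists_table hd)[T0 gT0] sg.
pose T := sort (fun r r' => lexle (src r) (src r')) T0.
have gT : istable H g T by apply: istable_perm gT0; rewrite perm_sym perm_sort.
have [ps pt aT] := gT.
have uS : uniq (map src T0).
  by have [p0 _ _] := gT0; apply: (part_uniq hd) => x; rewrite p0.
have uU : uniq (map tgt T) by apply: (part_uniq hd) => x; rewrite pt.
have srcT : map src T = sort lexle (map src T0) by rewrite sort_map.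
pose U := sort lexle (map tgt T).
have sU : size U = size T by rewrite size_sort size_map.
pose r0 : row d := ([::], [::], 1%g).
have ord_map (I : Type) (x0 : I) (s : seq I) : size s = size T ->
    [seq nth x0 s (nat_of_ord i) | i <- enum 'I_(size T)] = s.
  move=> ss; rewrite (map_comp (nth x0 s) (@nat_of_ord (size T))) val_enum_ord -ss.
  exact: mkseq_nth.
have tU (i : 'I_(size T)) : tgt (nth r0 T i) \in U by rewrite mem_sort map_f ?mem_nth.
have ti (i : 'I_(size T)) : index (tgt (nth r0 T i)) U < size T.
  by rewrite -[X in _ < X]sU index_mem.
pose t i := Ordinal (ti i).
have t_inj : injective t.
  move=> i j /(congr1 val) /= e.
  have {e} : tgt (nth r0 T i) = tgt (nth r0 T j).
    by rewrite -(nth_index [::] (tU i)) e nth_index.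
  rewrite -!(nth_map r0 [::]) // => /eqP; rewrite nth_uniq ?size_map //.
  by move=> /eqP/val_inj.
pose v (i : 'I_(size T)) := src (nth r0 T i).
pose u (i : 'I_(size T)) := nth [::] U i.
pose hs (i : 'I_(size T)) := lab (nth r0 T i).
have vE (i : 'I_(size T)) : v i = nth [::] (map src T) i by rewrite (nth_map r0).
have vs (i j : 'I_(size T)) : i < j -> lexlt (v i) (v j).
  move=> ij; rewrite !vE srcT; apply: sort_lexlt => //.
  by rewrite -(size_sort lexle) -srcT size_map.
have us (i j : 'I_(size T)) : i < j -> lexlt (u i) (u j).
  by move=> ij; apply: sort_lexlt; rewrite ?size_map.
have pv : ball_partition v.
  apply/ball_partition_part; rewrite (eq_map vE) ord_map ?size_map //.
have pu : ball_partition u.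
  apply/ball_partition_part; rewrite ord_map // => x; rewrite -(pt x).
  by apply/seq.permP; rewrite perm_sort.
have nT (i : 'I_(size T)) : nth r0 T i \in T by apply: mem_nth.
have Hh (i : 'I_(size T)) : hs i \in H by case: (aT _ (nT i)).
have gv (i : 'I_(size T)) y : g (app (v i) y) = app (u (perm t_inj i)) (lact (hs i) y).
  by rewrite permE /u /= nth_index // (aT _ (nT i)).2.
exists (size T), v, u, hs, (perm t_inj); do !split=> //.
by rewrite -(table_sgn vs us pv Hh gv) sg.
Qed.

Lemma inV'_sgn (g : wbij d) : inV' H g <-> inV H g /\ sgn g = false.
Proof.
rewrite /inV' dodd HA /=; split=> -[Vg]; last by move/(sgn_table Vg).
case=> m [v [u [hs [tau [vs [us [pv [_ [Hh [gv ev]]]]]]]]]]; split=> //.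
by rewrite (table_sgn vs us pv Hh gv) (negPf ev).
Qed.

End EvenTables.

(** * Equality of the derived subgroups of V_d(H) and V_d'(H) *)

Section DerivedSubgroups.
Variable d : nat.
Hypothesis hd : 1 < d.
Variable H : {group {perm 'I_d}}.
Implicit Types (x y g : wbij d).
Local Open Scope group_scope.

Notation V := (fun g : wbij d => inV H g).
Notation V' := (fun g : wbij d => inV' H g).

Lemma loc_commute (T : seq (row d)) y : locok T ->
  {in T, forall r, affr y (src r, src r, 1) /\ affr y (tgt r, tgt r, 1)} -> commute (loc T) y.
Proof.
move=> ok yT; rewrite /commute conjgC (loc_conj (m := id) ok yT).
by rewrite (eq_map (g := id)) ?map_id // => r; rewrite -rowE.
Qed.

(** The words bound the support of the generator. Two per generator make four for a pair, which is
    what [free_ball] can avoid. *)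
Lemma deep_support x : deep H 3 x -> exists l : seq (seq 'I_d),
  [/\ size l <= 2, all (fun v => 3 <= size v) l &
      forall v w, inc v w -> all (inc v) l -> all (inc w) l -> commute x (swap v w)].
Proof.
case=> [[v [w [vw v3 w3 ->]]]|[w [h [w3 _ ->]]]].
  exists [:: v; w]; split; rewrite /= ?v3 ?w3 // => a b ab.
  rewrite !andbT => /andP[av aw] /andP[bv bw].
  apply: loc_commute (swap_ok vw) _ => r.
  by rewrite !inE => /orP[]/eqP->; split; apply: swap_fix.
exists [:: w]; split; rewrite /= ?w3 // => a b ab; rewrite !andbT => aw bw.
apply: loc_commute (lam_ok w h) _ => r.
by rewrite inE => /eqP->; split; apply: swap_fix.
Qed.

Lemma commg_mul_comm (G : groupType) (x y t : G) :
  commute t x -> commute t y -> [~ x * t, y] = [~ x, y].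
Proof.
move=> tx ty; have xt : x ^ t = x by rewrite /conjg -tx mulKg.
have yt : y ^ t = y by rewrite /conjg -ty mulKg.
have ty' : t ^ y = t by rewrite /conjg ty mulKg.
rewrite commgEl conjMg ty' invgM -[RHS](_ : [~ x, y] ^ t = _).
  by rewrite commgEl /conjg !mulgA.
by rewrite conjRg xt yt.
Qed.

Section Special.
Hypothesis dodd : odd d.
Hypothesis HA : H \subset 'Alt_('I_d).

Let inV'P g : inV' H g <-> inV H g /\ sgn H g = false := inV'_sgn hd dodd HA g.

Lemma inV'V x : V' x -> V' x^-1.
Proof.
move=> /inV'P[Vx sx]; apply/inV'P; split; first exact: inVV.
by rewrite (sgnV hd dodd HA).
Qed.

Lemma inV'J x y : V y -> V' x -> V' (x ^ y).
Proof.
move=> Vy /inV'P[Vx sx]; have VI := inVV Vy; have Vxy := inVM Vx Vy.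
apply/inV'P; split; first exact: inVM.
by rewrite /conjg !(sgnM hd dodd HA) // sx (sgnV hd dodd HA) //= addbb.
Qed.

(* Deep generators leave room for a disjoint swap [t], which commutes with both;
   it is odd, so multiplying by it makes them even without changing the commutator. *)
Lemma deep_comm x y : deep H 3 x -> deep H 3 y -> comm V' [~ x, y].
Proof.
move=> Sx Sy; have [lx [lx2 lx3 xC]] := deep_support Sx.
have [ly [ly2 ly3 yC]] := deep_support Sy.
have [||z z3] := @free_ball d hd (lx ++ ly).
- by rewrite size_cat (leq_add lx2 ly2).
- by rewrite all_cat lx3.
rewrite all_cat => /andP[zx zy].
pose z1 := rcons z (Ordinal (ltnW hd)); pose z2 := rcons z (Ordinal hd).
have z12 : inc z1 z2 by rewrite inc_children.
have sub a l : all (inc z) l -> all (inc (rcons z a)) l.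
  by apply: sub_all => v; apply: inc_rconsl.
pose t := swap z1 z2.
have tx : commute t x by apply/commute_sym/xC; rewrite ?sub.
have ty : commute t y by apply/commute_sym/yC; rewrite ?sub.
have Vx : V x by apply: deep_inV Sx.
have Vy : V y by apply: deep_inV Sy.
have Vt : V t by apply: swap_inV.
have st : sgn H t by apply: (sgn_swap hd dodd HA).
have Vte (b : bool) : V (t ^+ b) by case: b => /=; [apply: Vt | apply: inV1].
have fix_sgn u : V u -> V' (u * t ^+ sgn H u).
  move=> Vu; apply/inV'P; split; first by apply: inVM => //; apply: Vte.
  rewrite (sgnM hd dodd HA) //; case su: (sgn H u); first by rewrite /= st.
  by rewrite expg0 (sgn1 hd dodd HA).
have := comm_commg inV'V (fix_sgn _ Vx) (fix_sgn _ Vy).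
have te (b : bool) u : commute t u -> commute (t ^+ b) u.
  by case: b => //= _; apply/commute_sym/commute1.
rewrite commg_mul_comm; first last.
- by apply: commuteM; [apply: te | apply: te; case: (sgn H y); [|apply: commute1]].
- exact: te.
rewrite -invgR commg_mul_comm ?invgR //; exact: te.
Qed.

(** Expanding a commutator of products leaves commutators of deep generators, conjugated by elements
    of V_d(H) that need not be even. This is harmless: V_d'(H) is normal in V_d(H), hence so is its
    derived subgroup. *)
Lemma inV_comm_special x : comm V x -> comm V' x.
Proof.
have gV y : gen (deep H 3) y -> V y.
  by elim=> [|a b Sa _ IH]; [apply: inV1 | apply: inVM IH; apply: deep_inV Sa].
have cJ u y : V y -> comm V' u -> comm V' (u ^ y).
  by move=> Vy; apply: commJ => z; apply: inV'J.
have deep_gen a y : deep H 3 a -> gen (deep H 3) y -> comm V' [~ a, y].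
  move=> Sa; elim=> [|b u Sb Gu IH]; first by rewrite commg1; apply: comm1.
  rewrite (_ : [~ a, b * u] = [~ a, u] * [~ a, b] ^ u); last first.
    by rewrite /commg /conjg !invgM !mulgA mulgK mulgK.
  by apply: commMM IH _; apply: cJ (gV _ Gu) _; apply: deep_comm.
have gen_gen a y : gen (deep H 3) a -> gen (deep H 3) y -> comm V' [~ a, y].
  move=> Ga Gy; elim: Ga => [|b u Sb Gu IH]; first by rewrite comm1g; apply: comm1.
  rewrite (_ : [~ b * u, y] = [~ b, y] ^ u * [~ u, y]); last first.
    by rewrite /commg /conjg !invgM !mulgA !mulgK.
  by apply: commMM _ IH; apply: cJ (gV _ Gu) _; apply: deep_gen.
apply: (@comm_sub _ V (comm V')) => [|u y|a b Va Vb]; [exact: comm1|exact: commMM|].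
have -> : b * a * b^-1 * a^-1 = [~ b^-1, a^-1] by rewrite /commg /conjg !invgK !mulgA.
by apply: gen_gen; apply: inV_gen => //; apply: inVV.
Qed.

End Special.

Lemma inV_comm x : comm V x -> comm V' x.
Proof.
case: (boolP (odd d && (H \subset 'Alt_('I_d)))) => [/andP[dodd HA]|nsp].
  exact: inV_comm_special.
elim=> [|f a b _ IH Va Vb]; first exact: comm1.
by apply: commM; rewrite // /inV' (negPf nsp).
Qed.

Lemma comm_inV x : comm V' x -> comm V x.
Proof.
elim=> [|f a b _ IH [Va _] [Vb _]]; first exact: comm1.
exact: commM.
Qed.

Lemma phi_comm (Q : zmodType) (eta : {perm 'I_d} -> Q) (eps : Q) x :
  {in H &, forall s t, eta (s * t) = (eta s + eta t)%R} ->
  (eps *+ 2 = 0)%R -> (eps *+ d = eps)%R ->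
  {in H, forall s, (eta s *+ d.-1 = eps *+ odd_perm s)%R} ->
  comm V x -> phi H eta eps x = 0%R.
Proof.
move=> etaM eps2 epsd etad.
have pM f g : V f -> V g -> phi H eta eps (f * g) = (phi H eta eps f + phi H eta eps g)%R.
  by move=> Vf Vg; apply: (phiM hd etaM eps2 epsd etad Vf Vg).
have p1 : phi H eta eps (1%g : wbij d) = 0%R.
  by have /eqP := pM 1 1 (inV1 H) (inV1 H); rewrite mulg1 -subr_eq0 opprD addNKr oppr_eq0 => /eqP.
have pV f : V f -> phi H eta eps f^-1 = (- phi H eta eps f)%R.
  move=> Vf; have /esym/eqP := pM _ _ (inVV Vf) Vf.
  by rewrite mulVg p1 addr_eq0 => /eqP.
move=> cx; suff [] : V x /\ phi H eta eps x = 0%R by [].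
apply: (@comm_sub _ V (fun x => V x /\ phi H eta eps x = 0%R)) cx.
- by split; [apply: inV1 | ].
- by move=> f g [Vf f0] [Vg g0]; split; [apply: inVM | rewrite pM // f0 g0 addr0].
move=> a b Va Vb; have VI := inVV Va; have VbI := inVV Vb.
have Vba := inVM Vb Va; have Vbab := inVM Vba VbI.
split; first exact: inVM.
by rewrite pM // pM // pM // !pV // addrAC addrK subrr.
Qed.

End DerivedSubgroups.

(** * Identification of the kernel, and the theorem *)

Section Kernel.
Variable d : nat.
Hypothesis hd : 1 < d.
Variable H : {group {perm 'I_d}}.
Local Open Scope group_scope.

(** The implication in the last clause merges the two cases of the definition: for d even it imposes
    nothing on [h]. *)
Lemma Nsub_facts : [/\ Nsub H \subset H, [~: H, H] \subset Nsub H &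
  forall h, h \in H -> odd d ==> ~~ odd_perm h -> h ^+ d.-1 \in Nsub H].
Proof.
have cH : [~: H, H] \subset H := der_sub 1 H.
rewrite /Nsub; case: ifP => od; split.
- rewrite gen_subG subUset cH; apply/subsetP => _ /imsetP[h /setIP[Hh _] ->].
  exact: groupX.
- by rewrite sub_gen // subsetUl.
- move=> h Hh /= ev; apply/mem_gen/setUP; right; apply/imsetP; exists h => //.
  by rewrite inE Hh Alt_even.
- by rewrite gen_subG subUset cH; apply/subsetP => _ /imsetP[h Hh ->]; apply: groupX.
- by rewrite sub_gen // subsetUl.
by move=> h Hh _; apply/mem_gen/setUP; right; apply/imsetP; exists h.
Qed.

Lemma Nsub_group : exists N : {group {perm 'I_d}}, Nsub H = N.
Proof. by rewrite /Nsub; case: ifP => _; eexists. Qed.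

(* In H/N the sign is carried by [eps], the common class of the [k ^+ d.-1] with [k]
   odd in [H], or 0 if there is none or [d] is even. *)
Lemma comm_lam_Nsub w h :
  h \in H -> comm (fun g : wbij d => inV H g) (lam w h) -> h \in Nsub H.
Proof.
have [NH HN XN] := Nsub_facts; have [N NE] := Nsub_group; rewrite NE in NH HN XN *.
have [||||||||Q [eta [etaM0 eta0]]] :=
    @abelian_quotient {perm 'I_d} (fun h => h \in H) (fun h => h \in N).
- exact: group1.
- by move=> x y; apply: groupM.
- exact: group1.
- by move=> x y; apply: groupM.
- by move=> x; rewrite groupV.
- by move=> x; rewrite groupV.
- exact: (subsetP NH).
- by move=> x y Hx Hy; apply/(subsetP HN)/mem_commg.
have etaM : {in H &, forall s t, eta (s * t) = (eta s + eta t)%R} by move=> s t; apply: etaM0.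
have etaX s n : s \in H -> eta (s ^+ n) = (eta s *+ n)%R.
  move=> Hs; elim: n => [|n IH]; first by rewrite expg0 mulr0n; apply/eta0; apply: group1.
  by rewrite expgS etaM ?groupX // IH mulrS.
have eta_even s : s \in H -> odd d ==> ~~ odd_perm s -> (eta s *+ d.-1 = 0)%R.
  by move=> Hs ev; rewrite -etaX //; apply/eta0; [apply: groupX | apply: XN].
have [eps [eps2 epsd etad]] : exists eps : Q, [/\ (eps *+ 2 = 0)%R, (eps *+ d = eps)%R &
    {in H, forall s, (eta s *+ d.-1 = eps *+ odd_perm s)%R}].
  case: (boolP [exists k in H, odd d && odd_perm k]) => [/exists_inP[k Hk /andP[od ok]]|].
    have eps2 : (eta k *+ d.-1 *+ 2 = 0)%R.
      by rewrite mulrnAC -etaX // eta_even ?groupX // odd_permM addbb implybT.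
    exists (eta k *+ d.-1)%R; split=> [//||s Hs].
      by rewrite -[X in (_ *+ X)%R = _]odd_double_half od -mul2n mulrnDr mulrnA eps2 mul0rn addr0.
    case: (boolP (odd_perm s)) => os; last by rewrite mulr0n eta_even // os implybT.
    (* Two odd elements differ by an even one, whose contribution vanishes, so all odd elements give
       the same [eps]. *)
    rewrite -(mulKVg k s) etaM ?groupM ?groupV // mulrnDl.
    rewrite [X in (_ + X)%R]eta_even ?addr0 ?groupM ?groupV //.
    by rewrite odd_permM odd_permV ok os implybT.
  rewrite negb_exists_in => /forall_inP noodd; exists 0%R; split=> [||s Hs]; rewrite ?mul0rn //.
  by apply: eta_even => //; have := noodd s Hs; rewrite negb_and implybE.
move=> Hh ch; apply/(eta0 _ Hh); rewrite -(phi_lam hd etaM eps2 epsd etad w Hh).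
exact: (phi_comm hd etaM eps2 epsd etad ch).
Qed.

Lemma Lambda1_lam (a : 'I_d) h : Lambda1 a h = lam [:: a] h :> (word d -> word d).
Proof.
apply: funext => x; apply: funext => n; rewrite /Lambda1.
have xa : inb [:: a] x = (x 0 == a) by rewrite /inb /= eqseq_cons andbT.
case: (boolP (x 0 == a)) => /= e; last by rewrite lam_out // xa (negPf e).
have /inbE[y ->] : inb [:: a] x by rewrite xa.
by rewrite (lam_in [:: a] h y) /app /lact /=; case: n.
Qed.

Lemma lam_inV' w h : h \in H -> inV' H (lam w h).
Proof.
move=> Hh; have Vl : inV H (lam w h) by apply: lam_inV.
case: (boolP (odd d && (H \subset 'Alt_('I_d)))) => [/andP[dodd HA]|nsp].
  by apply/(inV'_sgn hd dodd HA); rewrite (sgn_lam hd dodd HA).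
by rewrite /inV' (negPf nsp).
Qed.

Lemma sgn_comm (x : wbij d) : odd d -> H \subset 'Alt_('I_d) ->
  comm (fun g : wbij d => inV H g) x -> sgn H x = false.
Proof.
move=> dodd HA cx; suff [] : inV H x /\ sgn H x = false by [].
apply: (@comm_sub _ _ (fun x : wbij d => inV H x /\ sgn H x = false)) cx.
- by split; [apply: inV1 | apply: (sgn1 hd dodd HA)].
- by move=> f g [Vf f0] [Vg g0]; split; [apply: inVM | rewrite (sgnM hd dodd HA) // f0 g0].
move=> a b Va Vb; have VI := inVV Va; have VbI := inVV Vb.
have Vba := inVM Vb Va; have Vbab := inVM Vba VbI.
split; first exact: inVM.
rewrite !(sgnM hd dodd HA) // !(sgnV hd dodd HA) //.
by case: (sgn H a) (sgn H b) => [] [].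
Qed.

(** The swap factor is ruled out by parity: products of commutators and the copies of [h] are even
    and the swap is odd, so its presence would make [g] odd. *)
Lemma inV'_lam g (a := Ordinal (ltnW hd)) : inV' H (g : wbij d) ->
  exists2 h, h \in H & comm (fun g : wbij d => inV H g) (g * (lam [:: a] h)^-1).
Proof.
move=> V'g; have Vg : inV H g by case: V'g.
have [_ /(_ g Vg)[h [e [Hh esp ce]]]] := inV_abelian hd H.
case: e => [|] in esp ce *; last by exists h; rewrite // expg0 mulg1 in ce *.
have /andP[dodd HA] := esp isT.
have V0 : inV H (swap0 hd) by apply/swap_inV/inc_swap0.
have Vl : inV H (lam [:: a] h) by apply: lam_inV.
have Vm := inVM Vl V0; have VmV := inVV Vm.
have : sgn H (g * (lam [:: a] h * swap0 hd)^-1) = false := sgn_comm dodd HA ce.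
rewrite (sgnM hd dodd HA) // (sgnV hd dodd HA) // (sgnM hd dodd HA) //.
rewrite (sgn_lam hd dodd HA) // (sgn_swap hd dodd HA) ?inc_swap0 //.
by have /(inV'_sgn hd dodd HA)[_ ->] := V'g.
Qed.

End Kernel.

Local Open Scope group_scope.

Theorem theorem8p11 (d : nat) (hd : 1 < d) (H : {group {perm 'I_d}}) :
  let a1 : 'I_d := Ordinal (ltnW hd) in
  (* Lambda_1(h) lies in V_d'(H) *)
  (forall h, h \in H -> inV' H (Lambda1 a1 h)) /\
  (* h |-> pi(Lambda_1 h) is a homomorphism *)
  (forall h k, h \in H -> k \in H ->
     exists c, commsub (inV' H) c /\
       forall x, Lambda1 a1 (h * k) x = Lambda1 a1 h (Lambda1 a1 k (c x))) /\
  (* ... which is surjective onto V_d'(H)_ab *)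
  (forall g, inV' H g ->
     exists h, h \in H /\ exists c, commsub (inV' H) c /\
       forall x, g x = Lambda1 a1 h (c x)) /\
  (* ... with kernel N *)
  (forall h, h \in H -> (commsub (inV' H) (Lambda1 a1 h) <-> h \in Nsub H)).
Proof.
move=> a1; have LE h := Lambda1_lam a1 h.
pose L h := lam [:: a1] h.
have LV h : h \in H -> inV' H (L h) by apply: (lam_inV' hd).
split; [|split; [|split]] => [h Hh|h k Hh Hk|g V'g|h Hh].
- by rewrite LE; apply: LV.
(* The product of permutations applies [h] first, while the composite in the statement applies the
   copy of [k] first; this commutator makes up the difference. *)
- exists (L h * L k * (L h)^-1 * (L k)^-1); split=> [|x].
    by apply/commsubP; eexists; [reflexivity | apply: comm_gen; apply: LV].
  rewrite !LE -[RHS]/((L h * L k * (L h)^-1 * (L k)^-1 * L k * L h) x).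
  by rewrite /L lamM mulgVK mulgVK.
- have [gi gK giK] := inV_bij V'g.1.
  have [h Hh ch] := inV'_lam hd (g := Wbij gK giK) V'g.
  exists h; split=> //; exists (Wbij gK giK * (L h)^-1); split=> [|x].
    by apply/commsubP; eexists; [reflexivity | apply: (inV_comm hd ch)].
  by rewrite LE -[RHS]/((Wbij gK giK * (L h)^-1 * L h) x) mulgVK.
split=> [/commsubP[f fE cf]|Nh].
  apply: (comm_lam_Nsub hd (w := [:: a1]) Hh).
  have -> : lam [:: a1] h = f by apply: wbijP => x; rewrite -LE fE.
  exact: comm_inV cf.
apply/commsubP; exists (lam [:: a1] h); first exact: LE.
have [cN _] := inV_abelian hd H.
exact: (inV_comm hd (cN h Hh Nh)).
Qed.
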